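(* Let $X_1,\dots,X_n$ be $n$ independent copies of a random vector $X\in\mathbb{R}^d$. Assume that for some known constant $\kappa$, $\sup\{\mathbb{E}(\langle\theta,X\rangle^4):\theta\in\mathbb{R}^d,\ \mathbb{E}(\langle\theta,X\rangle^2)\le1\}\le\kappa<\infty$. Assume moreover that for some exponent $p\in(0,1]$ and some positive constants $\alpha$ and $\eta$, $$\mathbb{E}\Bigl\{\exp\Bigl[\frac\alpha2\Bigl(\|G^{-1/2}X\|^{2p}-\mathbb{E}(\|G^{-1/2}X\|^{2p})-\eta\Bigr)\Bigr]\Bigr\}\le1 .$$ Let $\epsilon>0$ be any confidence parameter and let the sample size $n$ be such that $$n>\Biggl[20\sqrt{\kappa d}+\Bigl(\frac52+\frac1{2(\kappa-1)}\Bigr)\sqrt{2(\kappa-1)\bigl[\log(\epsilon^{-1})+0.73\,d\bigr]}\Biggr]^2 .$$ Introduce the constant $$\widehat\gamma_+=\frac{2[\log(\epsilon^{-1})+0.73\,d]\bigl[\mathbb{E}(\|G^{-1/2}X\|^{2p})+2\alpha^{-1}\log(n/\epsilon)+\eta\bigr]^{2/p}(1+\widehat\delta)^2}{3(\kappa-1)n}\le\frac{2[\log(\epsilon^{-1})+0.73\,d]\bigl[d^p+2\alpha^{-1}\log(n/\epsilon)+\eta\bigr]^{2/p}(1+\widehat\delta)^2}{3(\kappa-1)n}.$$ With probability at least $1-\epsilon$, $\gamma_+\le\widehat\gamma_+$, so that with probability at least $1-3\epsilon$, for any $\theta\in\mathbb{R}^d$, $$-\frac{\widehat\delta+\gamma_-}{1+\widehat\delta}\le\frac{\overline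 N(\theta)}{N(\theta)}-1\le\frac{\widehat\delta+\widehat\gamma_+}{(1-\widehat\delta)(1-\widehat\gamma_+)_+},$$ where $$\frac{\widehat\delta+\gamma_-}{1+\widehat\delta}=\mathbf{O}(\widehat\delta),\qquad\frac{\widehat\delta+\widehat\gamma_+}{(1-\widehat\delta)(1-\widehat\gamma_+)_+}=\mathbf{O}_{n\to\infty}(\widehat\delta),\qquad\widehat\delta=\mathbf{O}\Biggl(\sqrt{\frac{\kappa[d+\log(\epsilon^{-1})]}{n}}\Biggr).$$
   Context: $N(\theta)=\mathbb{E}(\langle\theta,X\rangle^2)$, $\overline N(\theta)=\frac1n\sum_{i=1}^n\langle\theta,X_i\rangle^2$, $G=\mathbb{E}(XX^\top)$, $G^{-1/2}$ is the symmetric square root of the pseudo-inverse of $G$, $(z)_+=\max\{z,0\}$. $\mu=\sqrt{\frac{2(\kappa-1)}{n}[\log(\epsilon^{-1})+0.73\,d]}+6.81\sqrt{\frac{2\kappa d}{n}}$, $\widehat\delta=\frac{\mu}{1-2\mu}$, $\gamma_-=\frac{2[\log(\epsilon^{-1})+0.73\,d]}{3(\kappa-1)n}$, $\gamma_+=\frac{2[\log(\epsilon^{-1})+0.73\,d]R^4(1+\widehat\delta)^2}{3(\kappa-1)n}$ with $R=\max_{1\le i\le n}\|G^{-1/2}X_i\|$. Convention: $0/0=1$ and $z/0=+\infty$ for $z>0$. $A=\mathbf{O}(B)$ means that there is a numerical constant $c$ such that $A\le cB$; $A=\mathbf{O}_{n\to\infty}(B)$ means that there is a numerical constant $c$ such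 that $\limsup_{n\to\infty}A/B\le c$.
   Formalization: The upper bound on N̄/N−1 is claimed only when δ̂≤1 (for δ̂>1 it is negative and fails), and the constant in (δ̂+γ₋)/(1+δ̂)=O(δ̂) may depend on κ, nonincreasingly (no uniform constant works as κ→1); κ>1, log(1/ε)+0.73d≥0 and a nonnegative base of the 2/p power are assumed. *)

(* Defs.v *)
From HB Require Import structures.
From mathcomp Require Import all_boot all_order all_algebra.
From mathcomp Require Import all_classical all_reals all_analysis.

Set Implicit Arguments.
Unset Strict Implicit.
Unset Printing Implicit Defensive.

Import Order.TTheory GRing.Theory Num.Theory.
Import numFieldNormedType.Exports.

Local Open Scope classical_set_scope.
Local Open Scope ring_scope.

(* Division on \bar R with 0/0 = 1.  The library's 0^-1 is +oo, so z / 0 = +oo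
   for z > 0; its value for 0 / 0 would be 0. *)
Definition conv_div (R : realType) (x y : \bar R) : \bar R :=
  if (x == 0%E) && (y == 0%E) then 1%E else (x / y)%E.

(* "E holds with probability at least r".  The event E need not be known to be
   measurable; for a measurable E this is r <= P E. *)
Definition prob_at_least d (T : measurableType d) (R : realType)
    (P : probability T R) (E : set T) (r : R) : Prop :=
  exists A : set T, [/\ measurable A, A `<=` E & (r%:E <= P A)%E].

Section independent_copies.
Context {R : realType} {d0 d1 dS : measure_display}.
Context {T0 : measurableType d0} {T : measurableType d1}
        {S : measurableType dS}.

Definition mutually_independent (P : probability T R) (n : nat)
    (Xs : 'I_n -> {RV P >-> S}) : Prop :=
  forall (J : {set 'I_n}) (B : 'I_n -> set S),
    (forall i, i \in J -> measurable (B i)) ->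
    P [set w | forall i, i \in J -> B i (Xs i w)] =
    (\prod_(i in J) P (Xs i @^-1` B i))%E.

Definition same_law (P0 : probability T0 R) (P : probability T R)
    (X : {RV P0 >-> S}) (Y : {RV P >-> S}) : Prop :=
  forall B : set S, measurable B -> distribution P Y B = distribution P0 X B.

Definition independent_copies (P0 : probability T0 R) (P : probability T R)
    (X : {RV P0 >-> S}) (n : nat) (Xs : 'I_n -> {RV P >-> S}) : Prop :=
  mutually_independent Xs /\ forall i, same_law X (Xs i).

End independent_copies.

Section linear_algebra.
Context {R : realType} {d : nat}.

(* Random vectors take values in d.-tuple R, whose sigma-algebra in the library
   is the product one, i.e. the Borel sigma-algebra of R^d. *)
Definition vec (x : d.-tuple R) : 'cV[R]_d := \col_j tnth x j.

Definition inner (u v : 'cV[R]_d) : R := \sum_(j < d) u j 0 * v j 0.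

(* The library's norm on matrices is the sup norm. *)
Definition enorm (u : 'cV[R]_d) : R := Num.sqrt (inner u u).

Definition psd (A : 'M[R]_d) : Prop :=
  A^T = A /\ forall u : 'cV[R]_d, 0 <= inner u (A *m u).

(* The Moore-Penrose equations. *)
Definition is_pseudo_inverse (A B : 'M[R]_d) : Prop :=
  [/\ A *m B *m A = A, B *m A *m B = B,
      (A *m B)^T = A *m B & (B *m A)^T = B *m A].

(* Both matrices below are unique; they exist for every A, respectively for
   every positive semidefinite A. *)
Definition pseudo_inverse (A : 'M[R]_d) : 'M[R]_d :=
  xget 0 [set B | is_pseudo_inverse A B].

Definition sym_sqrt (A : 'M[R]_d) : 'M[R]_d :=
  xget 0 [set S | psd S /\ S *m S = A].

End linear_algebra.

Section law.
Context {R : realType} {d : nat} {d0 : measure_display}.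
Context {T0 : measurableType d0} {P : probability T0 R}.
Variable X : {RV P >-> d.-tuple R}.

Definition square_integrable : Prop :=
  forall j : 'I_d, ('E_P[fun w => (tnth (X w) j ^+ 2)%R] < +oo)%E.

Definition energy (theta : 'cV[R]_d) : \bar R :=
  'E_P[fun w => (inner theta (vec (X w)) ^+ 2)%R].

Definition fourth_moment (theta : 'cV[R]_d) : \bar R :=
  'E_P[fun w => (inner theta (vec (X w)) ^+ 4)%R].

Definition gram : 'M[R]_d :=
  \matrix_(i, j) fine ('E_P[fun w => (tnth (X w) i * tnth (X w) j)%R]).

Definition whitened_norm (x : d.-tuple R) : R :=
  enorm (sym_sqrt (pseudo_inverse gram) *m vec x).

(* Finite for a square integrable X and p <= 1. *)
Definition whitened_moment (p : R) : R :=
  fine ('E_P[fun w => (whitened_norm (X w) `^ (2 * p))%R]).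

End law.

Section constants.
Context {R : realType}.
Variables (d n : nat) (kappa eps : R).

Definition complexity : R := ln eps^-1 + 73 / 100 * d%:R.

Definition sample_threshold : R :=
  (20 * Num.sqrt (kappa * d%:R)
   + (5 / 2 + 1 / (2 * (kappa - 1)))
     * Num.sqrt (2 * (kappa - 1) * complexity)) ^+ 2.

Definition mu_ : R :=
  Num.sqrt (2 * (kappa - 1) / n%:R * complexity)
  + 681 / 100 * Num.sqrt (2 * kappa * d%:R / n%:R).

Definition delta_hat : R := mu_ / (1 - 2 * mu_).

Definition gamma_minus : R := 2 * complexity / (3 * (kappa - 1) * n%:R).

Definition gamma_plus_of (r4 : R) : R :=
  2 * complexity * r4 * (1 + delta_hat) ^+ 2 / (3 * (kappa - 1) * n%:R).

Definition tail_level (alpha eta m : R) : R :=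
  m + 2 * alpha^-1 * ln (n%:R / eps) + eta.

Definition gamma_plus_hat (p alpha eta m : R) : R :=
  gamma_plus_of (tail_level alpha eta m `^ (2 / p)).

Definition lower_bound : R := (delta_hat + gamma_minus) / (1 + delta_hat).

Definition upper_bound (g : R) : \bar R :=
  conv_div (delta_hat + g)%:E ((1 - delta_hat) * Num.max (1 - g) 0)%:E.

End constants.

Section sample.
Context {R : realType} {d n : nat} {d0 d1 : measure_display}.
Context {T0 : measurableType d0} {T : measurableType d1}.
Context {P0 : probability T0 R} {P : probability T R}.
Variables (X : {RV P0 >-> d.-tuple R}) (Xs : 'I_n -> {RV P >-> d.-tuple R}).

Definition empirical_energy (theta : 'cV[R]_d) (w : T) : R :=
  n%:R^-1 * \sum_(i < n) inner theta (vec (Xs i w)) ^+ 2.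

Definition max_whitened_norm (w : T) : R :=
  \big[Num.max/0]_(i < n) whitened_norm X (Xs i w).

Definition gamma_plus (kappa eps : R) (w : T) : R :=
  gamma_plus_of d n kappa eps (max_whitened_norm w ^+ 4).

Definition relative_error (theta : 'cV[R]_d) (w : T) : \bar R :=
  (conv_div (empirical_energy theta w)%:E (energy X theta) - 1)%E.

End sample.

(* Main.v *)
Require Import Defs.
From HB Require Import structures.
From mathcomp Require Import all_boot all_order all_algebra.
From mathcomp Require Import complex ring lra.
From mathcomp Require Import all_classical all_reals all_analysis.
From mathcomp Require Import measurable_realfun.

Set Implicit Arguments.
Unset Strict Implicit.
Unset Printing Implicit Defensive.

Import Order.TTheory GRing.Theory Num.Theory.
Import numFieldNormedType.Exports.

Local Open Scope classical_set_scope.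
Local Open Scope ring_scope.

(** Why the theorem is true.

Whitening. Let [G] be the Gram matrix, [W] the square root of its
pseudo-inverse and [Y = W X]. The covariance of [Y] is the orthogonal
projection [Q = W G W], and [theta] becomes [xi = W G theta]: the inner product
of [theta] with [X] is almost surely that of [xi] with [Y], and the energy of
[theta] is the squared norm of [xi]. After rescaling, the claim is therefore
about the mean of [inner xi Y_i ^ 2] over the sample, uniformly over the unit
vectors [xi] of the image of [Q]. A direction without energy is almost surely
orthogonal to the whole sample, and falls under the convention 0 / 0 = 1.

One direction. Chernoff's method is applied to the sum of
[lam * (inner u Y_i ^ 2 - 1)], or of its opposite. The variance of the square is
at most [kappa - 1], so the choice [lam ^ 2 = 2 C / (n (kappa - 1))], with [C]
the quantity [complexity], produces the first term of [mu_]. Second order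
expansions of the exponential need summands bounded from above, say by [K], and
then cost a relative error of order [K] ([expR_quadratic_le]). In the lower
bound [K] is about [lam], and [gamma_minus = lam ^ 2 / 3]; in the upper bound
[K] is [lam] times a bound [M] of the squared norms of the [Y_i], and
[gamma_plus] is [(lam M (1 + delta)) ^ 2 / 3]. In both cases the error, of order
[K * mu_], is absorbed by the corresponding [gamma] and by the excess of
[delta_hat] over [mu_] through the inequality between arithmetic and geometric
means ([lower_numeric] and [upper_numeric]).

All directions. Each [xi] is rounded to a point of the grid of mesh [h], and a
union bound is taken over the grid. Independent rounding of the coordinates,
with the right mean and with variance [h ^ 2 / 4], inflates a quadratic form on
average by exactly [h ^ 2 / 4] times its trace; hence near [xi] there is a grid
point where the inflation is no larger ([grid_rounding]). For the difference of
the empirical and the true second moments, the inflation is the mean of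
[h ^ 2 / 4] times the squared norm of [Y_i] minus its expectation, and it is
carried inside the exponential moment ([excess]) instead of being estimated
afterwards. This makes a rather coarse grid sufficient, with [h ^ 2] of order
[1 / C]; the logarithm of the number of its points is bounded by
[grid_count], and uniformity costs a multiple of [sqrt (2 kappa d / n)] well below
the factor 6.81 of [mu_]. In the lower bound the added squared norms are
unbounded, and the sample points of large norm are discarded first; the fourth
moments bound what is lost.

The remaining claims are softer: Markov's inequality for the exponential of
[p]-th powers bounds the norms of the [Y_i] ([white_norm_tail]), the concavity
of powers bounds the moment in [tail_level] ([whitened_moment_le]), and
[gamma_plus_hat], a power of a logarithm divided by the sample size, is
negligible with respect to [delta_hat] ([upper_bound_order]). *)

(** * Positive semidefinite matrices *)

Section spectral.
Context {R : realType}.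

Lemma interpolation (s : seq R) (f : R -> R) : uniq s ->
  exists p : {poly R}, {in s, forall a, p.[a] = f a}.
Proof.
elim: s => [|a s IH] /=; first by exists 0 => a.
move=> /andP[aNs /IH[p ps]].
pose q := \prod_(b <- s) ('X - b%:P).
have qa : q.[a] != 0 by rewrite -rootE root_prod_XsubC.
exists (p + ((f a - p.[a]) / q.[a]) *: q) => b; rewrite inE !hornerE.
have [-> _|_ /= bs] := eqVneq b a; first by rewrite divfK// addrC subrK.
have /eqP -> : q.[b] == 0 by rewrite -rootE root_prod_XsubC.
by rewrite mulr0 addr0 ps.
Qed.

(** The spectral theorem over the complex numbers gives a diagonal form with real
entries; a polynomial that vanishes at them annihilates the matrix, and this can
be read over the reals. *)
Lemma symmetric_annihilator n (A : 'M[R]_n.+1) : A^T = A ->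
  exists2 s : seq R, uniq s & horner_mx A (\prod_(a <- s) ('X - a%:P)) = 0.
Proof.
move=> symA; pose AC := map_mx (real_complex R) A.
have realA : AC \is a mxOver Num.real.
  by apply/mxOverP => i j; rewrite mxE complex_real.
have symAC : AC \is symmetricmx.
  by apply/is_hermitianmxP; rewrite expr0 scale1r; apply/matrixP => i j;
  rewrite !mxE -[in LHS]symA mxE.
have hermA := realsym_hermsym symAC realA.
have /orthomx_spectralP ACE := hermitian_normalmx hermA.
have /mxOverP spR := hermitian_spectral_diag_real hermA.
set sp := spectral_diag AC in ACE spR.
pose s := undup [seq complex.Re (sp 0 j) | j <- enum 'I_n.+1].
exists s; first exact: undup_uniq.
apply: (@map_mx_inj _ _ (real_complex R)).
rewrite map_horner_mx map_mx0 -/AC ACE horner_mx_uconjC ?spectral_unit//.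
rewrite horner_mx_diag (_ : map_mx _ _ = 0) ?linear0 ?mulmx0 ?mul0mx//.
apply/rowP => j; rewrite !mxE.
have spE : sp 0 j = (complex.Re (sp 0 j))%:C%C.
  by rewrite RRe_real// spR.
rewrite spE horner_map /= (rootP _) ?rmorph0//.
by rewrite root_prod_XsubC /s mem_undup; apply/mapP; exists j; rewrite ?mem_enum.
Qed.

(** The minimal polynomial divides the previous annihilator, so that only genuine
eigenvalues, whose sign is known for a psd matrix, remain. *)
Lemma symmetric_eigen_annihilator n (A : 'M[R]_n.+1) : A^T = A ->
  exists s : seq R, [/\ uniq s, all (eigenvalue A) s &
    horner_mx A (\prod_(a <- s) ('X - a%:P)) = 0].
Proof.
move=> /symmetric_annihilator[s us /mxminpoly_min /dvdp_prod_XsubC[m minE]].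
have rt a : root (mxminpoly A) a = (a \in mask m s).
  by rewrite (eqp_root minE) root_prod_XsubC.
exists (mask m s); split; first exact: mask_uniq.
  by apply/allP => a am; rewrite eigenvalue_root_min rt.
by apply/eqP; rewrite -dvd_mxminpoly (eqp_dvdl _ minE) dvdpp.
Qed.

Lemma eq_horner_mx n (A : 'M[R]_n.+1) (s : seq R) (p q : {poly R}) :
  uniq s -> horner_mx A (\prod_(a <- s) ('X - a%:P)) = 0 ->
  {in s, forall a, p.[a] = q.[a]} -> horner_mx A p = horner_mx A q.
Proof.
move=> us sA pq; apply/eqP; rewrite -subr_eq0 -rmorphB /= -dvd_mxminpoly.
apply: (dvdp_trans (mxminpoly_min sA)); apply: uniq_roots_dvdp.
  by apply/allP => a /pq; rewrite rootE !hornerE => ->; rewrite subrr.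
by rewrite uniq_rootsE.
Qed.

Lemma trmx_horner_mx n (A : 'M[R]_n.+1) (p : {poly R}) :
  A^T = A -> (horner_mx A p)^T = horner_mx A p.
Proof.
move=> symA; elim/poly_ind: p => [|p c IH]; first by rewrite !rmorph0 trmx0.
rewrite !rmorphD !rmorphM /= horner_mx_X horner_mx_C linearD /= trmx_mul IH.
rewrite symA tr_scalar_mx; congr (_ + _).
exact: (comm_mx_horner p (comm_mx_refl A)).
Qed.

End spectral.

Section inner.
Context {R : realType} {d : nat}.
Implicit Types (u v : 'cV[R]_d) (A B : 'M[R]_d).

Lemma innerE u v : inner u v = (u^T *m v) 0 0.
Proof. by rewrite /inner mxE; apply: eq_bigr => j _; rewrite mxE. Qed.

Lemma innerC u v : inner u v = inner v u.
Proof. by apply: eq_bigr => j _; rewrite mulrC. Qed.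

Lemma innerDl u v w : inner (u + v) w = inner u w + inner v w.
Proof. by rewrite -big_split; apply: eq_bigr => j _; rewrite mxE mulrDl. Qed.

Lemma innerDr u v w : inner w (u + v) = inner w u + inner w v.
Proof. by rewrite innerC innerDl !(innerC w). Qed.

Lemma innerZl c u w : inner (c *: u) w = c * inner u w.
Proof. by rewrite mulr_sumr; apply: eq_bigr => j _; rewrite mxE mulrA. Qed.

Lemma innerZr c u w : inner u (c *: w) = c * inner u w.
Proof. by rewrite innerC innerZl innerC. Qed.

Lemma inner_mulmx A u v : inner (A *m u) v = inner u (A^T *m v).
Proof. by rewrite !innerE trmx_mul mulmxA. Qed.

Lemma inner_ge0 u : 0 <= inner u u.
Proof. by apply: sumr_ge0 => j _; rewrite -expr2 sqr_ge0. Qed.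

Lemma enorm_sqr u : enorm u ^+ 2 = inner u u.
Proof. by rewrite sqr_sqrtr ?inner_ge0. Qed.

Lemma inner_delta (j : 'I_d) u : inner (delta_mx j 0) u = u j 0.
Proof.
rewrite /inner (bigD1 j)//= mxE !eqxx mul1r big1 ?addr0// => i /negPf ij.
by rewrite mxE ij mul0r.
Qed.

Lemma psd_sqr B : B^T = B -> psd (B *m B).
Proof.
move=> symB; split; first by rewrite trmx_mul symB.
by move=> u; rewrite -mulmxA -[X in X *m (_ *m _)]symB -inner_mulmx inner_ge0.
Qed.

End inner.

Section psd_calculus.
Context {R : realType}.

Lemma psd_eigen_annihilator n (A : 'M[R]_n.+1) : psd A ->
  exists s : seq R, [/\ uniq s, {in s, forall a, 0 <= a} &
    horner_mx A (\prod_(a <- s) ('X - a%:P)) = 0].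
Proof.
move=> [symA psdA]; have [s [us /allP es sA]] := symmetric_eigen_annihilator symA.
exists s; split=> // a /es /eigenvalueP[v vA v0].
have := psdA v^T; rewrite -{1}symA -trmx_mul vA linearZ innerZr.
rewrite pmulr_lge0// lt_neqAle inner_ge0 andbT eq_sym.
apply: contra v0 => /eqP v0; apply/eqP/rowP => j; rewrite mxE.
have /psumr_eq0P/(_ j isT) := v0; rewrite !mxE -expr2 => H.
by apply/eqP; rewrite -sqrf_eq0 H// => i _; rewrite -expr2 sqr_ge0.
Qed.

(** Functional calculus: [F f] is the polynomial in [A] that interpolates [f] at
the eigenvalues, so that identities between functions on the half-line transfer
to matrices. *)
Lemma psd_calculus n (A : 'M[R]_n.+1) : psd A ->
  exists F : (R -> R) -> 'M[R]_n.+1, [/\ F id = A,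
    forall f g, (forall a, 0 <= a -> f a = g a) -> F f = F g,
    forall f g, F (fun a => f a * g a) = F f *m F g &
    forall f, (F f)^T = F f].
Proof.
move=> psdA; have [s [us s0 sA]] := psd_eigen_annihilator psdA.
pose F f := horner_mx A (projT1 (cid (interpolation f us))).
have FE f a : a \in s -> (projT1 (cid (interpolation f us))).[a] = f a.
  by case: cid => /= p; exact.
exists F; split.
- rewrite /F -[RHS]horner_mx_X; apply: (eq_horner_mx us sA) => a /FE ->.
  by rewrite hornerX.
- move=> f g fg; apply: (eq_horner_mx us sA) => a sa.
  by rewrite !FE// fg// s0.
- move=> f g; rewrite /F mulmxE -rmorphM; apply: (eq_horner_mx us sA) => a sa.
  by rewrite hornerM !FE.
- by move=> f; apply: trmx_horner_mx; case: psdA.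
Qed.

Lemma sym_sqrtP d (A : 'M[R]_d) : psd A ->
  psd (sym_sqrt A) /\ sym_sqrt A *m sym_sqrt A = A.
Proof.
move=> psdA; rewrite /sym_sqrt.
suff [S SE] : exists S : 'M[R]_d, psd S /\ S *m S = A.
  exact: (@xgetI _ 0 [set S | psd S /\ S *m S = A] S SE).
case: d A psdA => [|n] A psdA.
  by exists A; split=> //; apply/matrixP => - [].
have [F [F1 Fext FM Ftr]] := psd_calculus psdA.
exists (F Num.sqrt); split.
(* Psd, being the square of the fourth root. *)
- rewrite (_ : F _ = F (fun a => Num.sqrt (Num.sqrt a)) *m
                     F (fun a => Num.sqrt (Num.sqrt a))); first exact: psd_sqr.
  by rewrite -FM; apply: Fext => a a0; rewrite -expr2 sqr_sqrtr ?sqrtr_ge0.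
- by rewrite -FM -[RHS]F1; apply: Fext => a a0; rewrite -expr2 sqr_sqrtr.
Qed.

(** Identifies the pseudo-inverse chosen in the definition with the one that the
functional calculus provides, which is psd. *)
Lemma pseudo_inverse_unique d (A B C : 'M[R]_d) :
  is_pseudo_inverse A B -> is_pseudo_inverse A C -> B = C.
Proof.
move=> [ABA BAB ABt BAt] [ACA CAC ACt CAt].
have AB : A *m B = A *m C.
  rewrite -[LHS]ABt -[in LHS]ACA -(mulmxA (A *m C)) trmx_mul ABt ACt.
  by rewrite mulmxA ABA.
have BA : B *m A = C *m A.
  rewrite -[LHS]BAt -[in LHS]ACA -mulmxA mulmxA trmx_mul CAt BAt.
  by rewrite -mulmxA (mulmxA A) ABA.
by rewrite -BAB BA -mulmxA AB mulmxA.
Qed.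

Lemma pseudo_inverseP d (A : 'M[R]_d) : psd A ->
  is_pseudo_inverse A (pseudo_inverse A) /\ psd (pseudo_inverse A).
Proof.
move=> psdA; rewrite /pseudo_inverse.
suff [B BE psdB] : exists2 B : 'M[R]_d, is_pseudo_inverse A B & psd B.
  have := @xgetI _ 0 [set B | is_pseudo_inverse A B] B BE.
  by move: (xget _ _) => C /= CE; rewrite (pseudo_inverse_unique CE BE).
case: d A psdA => [|n] A psdA.
  by exists A => //; split; apply/matrixP => - [].
have [F [F1 Fext FM Ftr]] := psd_calculus psdA.
have Vr a : a * a^-1 * a = a :> R.
  have [->|a0] := eqVneq a 0; first by rewrite !mul0r.
  by rewrite mulfV// mul1r.
exists (F (fun a => a^-1)).
  rewrite -F1; split; rewrite -?FM ?Ftr//.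
  - by apply: Fext => a _; rewrite Vr.
  - by apply: Fext => a _; rewrite -[X in _ = X](Vr a^-1) invrK.
rewrite (_ : F _ = F (fun a => Num.sqrt a^-1) *m F (fun a => Num.sqrt a^-1)).
  exact: psd_sqr.
by rewrite -FM; apply: Fext => a a0; rewrite -expr2 sqr_sqrtr ?invr_ge0.
Qed.

End psd_calculus.

(** * Rounding to a grid *)

Section rounding.
Context {R : realType}.

(** The three integers nearest to [x] carry weights of mean [x] and variance 1/4,
so the left-hand side of the inequality has mean [a / 4]. *)
Lemma rounding1 (x l a : R) : exists k : int,
  `|k%:~R - x| <= 3 / 2 /\ (k%:~R - x) * l + (k%:~R - x) ^+ 2 * a <= a / 4.
Proof.
pose k0 := Num.floor (x + 1 / 2); pose f := x - k0%:~R.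
have f_ge : - (1 / 2) <= f.
  have := Num.Theory.floor_le (x + 1 / 2); rewrite -/k0 /f; lra.
have f_le : f <= 1 / 2.
  by have := floorD1_gt (x + 1 / 2); rewrite -/k0 intrD /f; lra.
pose g t := t * l + t ^+ 2 * a.
have [g0|g0] := leP (g (- f)) (a / 4).
  exists k0; rewrite (_ : k0%:~R - x = - f); last by rewrite /f; ring.
  by split=> //; rewrite normrN ler_norml; lra.
have [g1|g1] := leP (g (1 - f)) (a / 4).
  exists (k0 + 1); rewrite intrD (_ : k0%:~R + _ - x = 1 - f); last first.
    by rewrite /f; ring.
  by split=> //; rewrite ler_norml; lra.
have [gN1|gN1] := leP (g (- 1 - f)) (a / 4).
  exists (k0 - 1); rewrite intrB (_ : k0%:~R - _ - x = - 1 - f); last first.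
    by rewrite /f; ring.
  by split=> //; rewrite ler_norml; lra.
exfalso.
(* The weights are the values of the quadratic B-spline. *)
have : (3 / 4 - f ^+ 2) * (g (- f) - a / 4)
     + (f + 1 / 2) ^+ 2 / 2 * (g (1 - f) - a / 4)
     + (f - 1 / 2) ^+ 2 / 2 * (g (- 1 - f) - a / 4) = 0.
  by rewrite /g; field.
apply/eqP; rewrite gt_eqF// -addrA ltr_wpDr//.
  by apply: addr_ge0; apply: mulr_ge0; rewrite ?divr_ge0 ?sqr_ge0 ?subr_ge0 ?ltW.
by apply: mulr_gt0; rewrite ?subr_gt0//; nra.
Qed.

Variable d : nat.

Lemma quadratic_shift (A : 'M[R]_d) (u : 'cV[R]_d) (j : 'I_d) (t : R) :
  inner (u + t *: delta_mx j 0) (A *m (u + t *: delta_mx j 0)) =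
  inner u (A *m u) + (t * ((A *m u) j 0 + (A^T *m u) j 0) + t ^+ 2 * A j j).
Proof.
rewrite mulmxDr -scalemxAr innerDl !innerDr !innerZl !innerZr.
rewrite (innerC u (A *m delta_mx j 0)) inner_mulmx !inner_delta.
rewrite (_ : (_ *m delta_mx j 0) j 0 = A j j); first by ring.
rewrite mxE (bigD1 j)//= !mxE !eqxx mulr1 big1 ?addr0// => i /negPf ij.
by rewrite !mxE ij mulr0.
Qed.

(** Coordinates are rounded one after the other, each time without exceeding the
mean over the random rounding of that coordinate. *)
Lemma rounding (A : 'M[R]_d) (u : 'cV[R]_d) : exists k : 'I_d -> int,
  (forall j, `|(k j)%:~R - u j 0| <= 3 / 2) /\
  inner (\col_j (k j)%:~R) (A *m \col_j (k j)%:~R)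
    <= inner u (A *m u) + \tr A / 4.
Proof.
suff /(_ d (leqnn d)) [w [wk _ wA]] : forall m, (m <= d)%N ->
    exists w : 'cV[R]_d, [/\
      forall j : 'I_d, (j < m)%N ->
        exists k : int, w j 0 = k%:~R /\ `|k%:~R - u j 0| <= 3 / 2,
      forall j : 'I_d, (m <= j)%N -> w j 0 = u j 0 &
      inner w (A *m w) <= inner u (A *m u) + (\sum_(j < d | (j < m)%N) A j j) / 4].
  have {}wk j := cid (wk j (ltn_ord j)).
  exists (fun j => projT1 (wk j)).
  have -> : \col_j (projT1 (wk j))%:~R = w.
    by apply/colP => j; rewrite mxE; case: (wk j) => k [].
  split; first by move=> j; case: (wk j) => k [].
  by move: wA; under eq_bigl do rewrite ltn_ord.
elim=> [_|m IH md].
  by exists u; split=> //; rewrite big_pred0_eq mul0r addr0.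
have [w [wk wu wA]] := IH (ltnW md); pose i := Ordinal md.
have [k [ki kA]] := rounding1 (w i 0) ((A *m w) i 0 + (A^T *m w) i 0) (A i i).
exists (w + (k%:~R - w i 0) *: delta_mx i 0); split.
- move=> j; rewrite ltnS leq_eqVlt => /predU1P[ji|jm].
    have -> : j = i by exact/val_inj.
    exists k; rewrite !mxE !eqxx mulr1 addrC subrK; split=> //.
    by rewrite -wu.
  have [k' [k'E k'u]] := wk j jm; exists k'; split=> //.
  by rewrite !mxE (_ : j == i = false) ?mulr0 ?addr0// -val_eqE/= ltn_eqF.
- move=> j mj; rewrite !mxE (_ : j == i = false) ?mulr0 ?addr0 ?wu// 1?ltnW//.
  by rewrite -val_eqE/= gtn_eqF.
- rewrite quadratic_shift (bigD1 i)//=.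
  rewrite (eq_bigl (fun j : 'I_d => (j < m)%N)); first by lra.
  by move=> j; rewrite ltnS -val_eqE/= andbC -ltn_neqAle.
Qed.

Lemma grid_rounding (h : R) (A : 'M[R]_d) (u : 'cV[R]_d) : 0 < h ->
  exists k : 'I_d -> int, let w := \col_j (h * (k j)%:~R) in
  (forall j, `|w j 0 - u j 0| <= 3 / 2 * h) /\
  inner w (A *m w) <= inner u (A *m u) + h ^+ 2 / 4 * \tr A.
Proof.
move=> h0; have [k [ku kA]] := rounding A (h^-1 *: u).
exists k => w; have wE : w = h *: \col_j (k j)%:~R by apply/colP=> j; rewrite !mxE.
have uE : u = h *: (h^-1 *: u) by rewrite scalerA mulfV ?scale1r ?gt_eqF.
split=> [j|].
  have := ku j; rewrite !mxE => kuj.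
  rewrite (_ : h * _ - _ = h * ((k j)%:~R - h^-1 * u j 0)); last first.
    by rewrite mulrBr mulrA mulfV ?mul1r ?gt_eqF.
  by rewrite normrM gtr0_norm// mulrC ler_wpM2r// ltW.
have qZ c v : inner (c *: v) (A *m (c *: v)) = c ^+ 2 * inner v (A *m v).
  by rewrite -scalemxAr innerZl innerZr expr2 mulrA.
rewrite wE {1 2}uE !(qZ h) (le_trans (ler_wpM2l (sqr_ge0 h) kA))//.
by rewrite mulrDr [_ * (_ / 4)]mulrA [h ^+ 2 / 4 * _]mulrAC.
Qed.

End rounding.

Section grid_count.
Context {R : realType}.

Lemma geometric_sum_le (x : R) m : 0 <= x < 1 ->
  \sum_(i < m) x ^+ i <= (1 - x)^-1.
Proof.
move=> /andP[x0 x1]; rewrite -[leRHS]mul1r ler_pdivlMr ?subr_gt0//.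
have := subrX1 x m => H.
have -> : (\sum_(i < m) x ^+ i) * (1 - x) = 1 - x ^+ m.
  by rewrite mulrC -opprB mulNr -H opprB.
by rewrite lerBlDr lerDl exprn_ge0.
Qed.

(** Integers of absolute value less than [m], coded by a sign and a modulus;
zero has two codes, which is harmless when counting from above. *)
Definition signed_nat {m} (c : bool * 'I_m) : R := (-1) ^+ c.1 * (c.2 : nat)%:R.

(** Let [c] weigh [x] to the power of the sum of its moduli, where
[x = rho / (1 + rho)]. The total weight is a product of geometric sums over the
coordinates, and no point of the set weighs less than [exp (- d)]. *)
Lemma grid_count (d m : nat) (rho : R) : 0 < rho ->
  #|[set c : {ffun 'I_d -> bool * 'I_m} |
      \sum_j `|signed_nat (c j)| <= rho * d%:R]%SET|%:R
  <= expR (d%:R * (1 + ln (2 * (1 + rho)))).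
Proof.
move=> rho0; set N := [set c | _]%SET; pose x := rho / (1 + rho).
have rho1 : 0 < 1 + rho by lra.
have x01 : 0 <= x < 1.
  by rewrite /x ltr_pdivrMr// mul1r divr_ge0 ?(ltW rho0) ?(ltW rho1)//=; lra.
have x_ge : expR (- rho^-1) <= x.
  rewrite expRN -[leRHS]invrK lef_pV2 ?posrE ?expR_gt0 ?invr_gt0 ?divr_gt0//.
  rewrite (_ : x^-1 = 1 + rho^-1) ?expR_ge1Dx//.
  by rewrite /x invf_div mulrDl mul1r divff ?gt_eqF// addrC.
pose wt (c : {ffun 'I_d -> bool * 'I_m}) := \prod_j x ^+ (c j).2.
have wtN c : c \in N -> expR (- d%:R) <= wt c.
  rewrite inE => cN; rewrite /wt prodrXr.
  apply: (@le_trans _ _ (expR (- rho^-1) ^+ (\sum_j (c j).2))).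
    rewrite -expRM_natl ler_expR mulrN lerN2 ler_pdivrMr// [leRHS]mulrC.
    rewrite (le_trans _ cN)// natr_sum le_eqVlt; apply/orP; left; apply/eqP.
    by apply: eq_bigr => j _; rewrite normrM normrX normrN1 expr1n mul1r ger0_norm.
  by rewrite lerXn2r// nnegrE ?expR_ge0; case/andP: x01.
have wt_sum : \sum_c wt c <= (2 * (1 + rho)) ^+ d.
  rewrite -(bigA_distr_bigA (fun j (p : bool * 'I_m) => x ^+ p.2)) /=.
  rewrite prodr_const card_ord lerXn2r ?nnegrE//; last 2 first.
  - by rewrite mulr_ge0 ?ltW.
  - rewrite -(pair_big xpredT xpredT (fun (b : bool) (i : 'I_m) => x ^+ i)) /=.
    rewrite sumr_const card_bool -[leLHS]mulr_natl ler_wpM2l//.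
    apply: (le_trans (geometric_sum_le _ x01)).
    rewrite (_ : 1 - x = (1 + rho)^-1) ?invrK//.
    by rewrite /x -[X in X - _](@divff _ (1 + rho)) ?gt_eqF// -mulrBl addrK mul1r.
  by apply: sumr_ge0 => p _; rewrite exprn_ge0//; case/andP: x01.
have -> : expR (d%:R * (1 + ln (2 * (1 + rho)))) =
          expR (d%:R) * (2 * (1 + rho)) ^+ d.
  by rewrite mulrDr mulr1 expRD expRM_natl lnK// posrE mulr_gt0.
rewrite mulrC -ler_pdivrMr ?expR_gt0// -expRN; apply: le_trans wt_sum.
rewrite mulr_natl -sumr_const [leRHS](bigID [in N])/= ler_wpDr//.
  apply: sumr_ge0 => c _; apply: prodr_ge0 => j _.
  by rewrite exprn_ge0//; case/andP: x01.
exact: ler_sum.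
Qed.

End grid_count.

(** * Independence and exponential moments *)

Section independence.
Context {R : realType} {dS dT : measure_display}.
Context {S : measurableType dS} {T : measurableType dT}.
Variable P : probability T R.
Import HBNNSimple.

Lemma integral_indep_nnsfun (g : T -> R) (X : T -> S) (c : R)
    (h : {nnsfun S >-> R}) :
  measurable_fun [set: T] g -> (forall x, 0 <= g x) ->
  measurable_fun [set: T] X ->
  (forall B, measurable B ->
    \int[P]_x (g x * \1_B (X x))%:E = c%:E * P (X @^-1` B))%E ->
  (\int[P]_x (g x * h (X x))%:E = c%:E * \int[P]_x (h (X x))%:E)%E.
Proof.
move=> mg g0 mX gB.
have mpre r : measurable (X @^-1` (h @^-1` [set r])).
  by rewrite -[X in measurable X]setTI; apply: mX.
have mind r : measurable_fun [set: T] (fun x => \1_(h @^-1` [set r]) (X x) : R).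
  rewrite (_ : (fun x => _) = \1_(X @^-1` (h @^-1` [set r]))) //.
have neg r : r < 0 -> h @^-1` [set r] = set0.
  move=> r0; apply/seteqP; split=> // x /= hx.
  by move: r0; rewrite -hx ltNge fun_ge0.
have ge0_term r x : (0 <= (r * \1_(h @^-1` [set r]) (X x))%:E)%E.
  by rewrite EFinM; exact: nnfun_muleindic_ge0.
have hE x : h (X x) = \sum_(r \in range h) (r * \1_(h @^-1` [set r]) (X x)).
  exact: fimfunE.
have int1 r : (\int[P]_x (\1_(h @^-1` [set r]) (X x))%:E =
    P (X @^-1` (h @^-1` [set r])))%E.
  transitivity (\int[P]_x (\1_(X @^-1` (h @^-1` [set r])) x)%:E)%E.
    exact: eq_integral.
  by rewrite integral_indic// setIT.
have int_h : (\int[P]_x (h (X x))%:E =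
    \sum_(r \in range h) (r%:E * P (X @^-1` (h @^-1` [set r]))))%E.
  under eq_integral do rewrite hE -fsumEFin//.
  rewrite ge0_integral_fsum//; last first.
    by move=> r; apply/measurable_EFinP/measurable_funM.
  apply: eq_fsbigr => r _.
  have [r0|/neg ->] := leP 0 r.
    under eq_integral do rewrite EFinM.
    by rewrite ge0_integralZl ?int1//; exact/measurable_EFinP.
  rewrite preimage_set0 measure0 mule0.
  by under eq_integral do rewrite indic0 mulr0; rewrite integral0.
rewrite int_h ge0_mule_fsumr//; last first.
  move=> r; have [r0|/neg ->] := leP 0 r; first by rewrite mule_ge0// lee_fin.
  by rewrite preimage_set0 measure0 mule0.
have ghE x : ((g x * h (X x))%:E = \sum_(r \in range h)
    ((g x)%:E * (r * \1_(h @^-1` [set r]) (X x))%:E))%E.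
  by rewrite EFinM hE -fsumEFin// ge0_mule_fsumr.
under eq_integral do rewrite ghE.
rewrite ge0_integral_fsum//; last 2 first.
- move=> r; apply: emeasurable_funM => //; first exact/measurable_EFinP.
  by apply/measurable_EFinP/measurable_funM.
- by move=> r x _; rewrite mule_ge0// lee_fin.
apply: eq_fsbigr => r _.
have [r0|/neg ->] := leP 0 r.
  transitivity (\int[P]_x (r%:E *
      (g x * \1_(h @^-1` [set r]) (X x))%:E))%E.
    by apply: eq_integral => x _; rewrite -!EFinM mulrCA.
  rewrite ge0_integralZl//.
  - by rewrite gB// muleCA.
  - by apply/measurable_EFinP; exact: measurable_funM.
  - by move=> x _; rewrite lee_fin mulr_ge0.
rewrite preimage_set0 measure0 !mule0.
by under eq_integral do rewrite indic0 mulr0 mule0; rewrite integral0.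
Qed.

(** From indicators of [X] to simple functions by linearity, and to nonnegative
functions by monotone convergence. *)
Lemma integral_indep (g : T -> R) (X : T -> S) (c : R) (f : S -> R) :
  measurable_fun [set: T] g -> (forall x, 0 <= g x) ->
  measurable_fun [set: T] X ->
  measurable_fun [set: S] f -> (forall y, 0 <= f y) ->
  (forall B, measurable B ->
    \int[P]_x (g x * \1_B (X x))%:E = c%:E * P (X @^-1` B))%E ->
  (\int[P]_x (g x * f (X x))%:E = c%:E * \int[P]_x (f (X x))%:E)%E.
Proof.
move=> mg g0 mX mf f0 gB.
have mEf : measurable_fun [set: S] (EFin \o f) by exact/measurable_EFinP.
pose h := nnsfun_approx measurableT mEf.
have h_nd := nd_nnsfun_approx measurableT mEf.
have h_cvg y : (h n y)%:E @[n --> \oo] --> (f y)%:E.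
  by apply: cvg_nnsfun_approx => // x _; rewrite lee_fin.
have mh n : measurable_fun [set: T] (fun x => h n (X x)).
  exact: measurableT_comp.
have hXcvg x : (h n (X x))%:E @[n --> \oo] --> (f (X x))%:E by exact: h_cvg.
have h_ndE x m n : (m <= n)%N -> h m (X x) <= h n (X x).
  by move=> mn; exact/lefP/h_nd.
have cvg1 : (\int[P]_x (h n (X x))%:E)%E @[n --> \oo] -->
            (\int[P]_x (f (X x))%:E)%E.
  rewrite [X in _ --> X](_ : _ = \int[P]_x (limn (fun n => (h n (X x))%:E)))%E.
    apply: cvg_monotone_convergence => //.
    - by move=> n; exact/measurable_EFinP.
    - by move=> n x _; rewrite lee_fin.
    - by move=> x _ m n mn; rewrite lee_fin h_ndE.
  by apply: eq_integral => x _; apply/esym/cvg_lim.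
have cvg2 : (\int[P]_x (g x * h n (X x))%:E)%E @[n --> \oo] -->
            (\int[P]_x (g x * f (X x))%:E)%E.
  rewrite [X in _ --> X](_ : _ =
      \int[P]_x (limn (fun n => (g x * h n (X x))%:E)))%E.
    apply: cvg_monotone_convergence => //.
    - by move=> n; apply/measurable_EFinP; exact: measurable_funM.
    - by move=> n x _; rewrite lee_fin mulr_ge0.
    - by move=> x _ m n mn; rewrite lee_fin ler_wpM2l// h_ndE.
  apply: eq_integral => x _; apply/esym/cvg_lim => //.
  under eq_fun do rewrite EFinM; rewrite EFinM.
  exact: cvgeZl.
move: cvg2; rewrite (_ : (fun n => _) =
  (fun n => c%:E * \int[P]_x (h n (X x))%:E)%E) => [cvg2|].
  by apply: cvg_unique cvg2 _ => //; exact: cvgeZl.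
by apply/funext => n; exact: integral_indep_nnsfun.
Qed.

End independence.

Section markov_inequality.
Context {R : realType} {d : measure_display} {T : measurableType d}.
Variable P : probability T R.

Lemma markov_ineq (f : T -> R) (c K : R) : measurable_fun [set: T] f ->
  (forall x, 0 <= f x) -> 0 < c -> (\int[P]_x (f x)%:E <= K%:E)%E ->
  (P [set x | (c <= f x)%R] <= (K / c)%:E)%E.
Proof.
move=> mf f0 c0 fK; set A := [set x | _].
have mA : measurable A by rewrite -[A]setTI; exact: measurable_fun_le.
have : (c%:E * P A <= \int[P]_x (f x)%:E)%E.
  rewrite -[leLHS](integral_cst P mA).
  apply: (@le_trans _ _ (\int[P]_(x in A) (f x)%:E)%E).
    apply: ge0_le_integral => //.
    - by move=> x _; rewrite lee_fin ltW.
    - by apply/measurable_EFinP; exact: measurable_funTS.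
  apply: ge0_subset_integral => //; first exact/measurable_EFinP.
  by move=> x _; rewrite lee_fin.
move=> /le_trans/(_ fK); rewrite -(@fineK _ (P A)) ?fin_num_measure//.
by rewrite -EFinM !lee_fin ler_pdivlMr// mulrC.
Qed.

End markov_inequality.

Section chernoff.
Context {R : realType} {d0 d1 dS : measure_display}.
Context {T0 : measurableType d0} {T : measurableType d1}
        {S : measurableType dS}.
Variables (P0 : probability T0 R) (P : probability T R) (n : nat).
Variables (X : {RV P0 >-> S}) (Xs : 'I_n -> {RV P >-> S}).

Lemma integral_indic_RV (Y : {RV P >-> S}) B : measurable B ->
  (\int[P]_x (\1_B (Y x) : R)%:E = P (Y @^-1` B))%E.
Proof.
move=> mB; transitivity (\int[P]_x (\1_(Y @^-1` B) x)%:E)%E.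
  exact: eq_integral.
rewrite integral_indic ?setIT//.
by rewrite -[X in measurable X]setTI; exact: (measurable_funPT Y).
Qed.

(** Independence is a statement about indicators of the [Xs i]; the indicators
are traded for nonnegative functions one index at a time. *)
Lemma integral_prod_indep (F : 'I_n -> S -> R) :
  mutually_independent Xs ->
  (forall i, measurable_fun [set: S] (F i)) -> (forall i y, 0 <= F i y) ->
  (forall i, (\int[P]_x (F i (Xs i x))%:E < +oo)%E) ->
  (\int[P]_x (\prod_i F i (Xs i x))%:E =
   \prod_i \int[P]_x (F i (Xs i x))%:E)%E.
Proof.
move=> indep.
suff main k : forall F : 'I_n -> S -> R,
    (forall i, measurable_fun [set: S] (F i)) -> (forall i y, 0 <= F i y) ->
    (forall i, (\int[P]_x (F i (Xs i x))%:E < +oo)%E) ->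
    (forall i : 'I_n, (k <= i)%N -> exists2 B, measurable B & F i = \1_B) ->
    (\int[P]_x (\prod_i F i (Xs i x))%:E =
     \prod_i \int[P]_x (F i (Xs i x))%:E)%E.
  move=> mF F0 Foo; apply: (main n) => // i.
  by rewrite leqNgt ltn_ord.
elim: k => [|k IH] {}F mF F0 Foo Find.
  have {}Find i : exists B, measurable B /\ F i = \1_B.
    by have [B mB FE] := Find i isT; exists B.
  pose B i := projT1 (cid (Find i)).
  have mB i : measurable (B i) by rewrite /B; case: cid => ? [].
  have FE i : F i = \1_(B i) by rewrite /B; case: cid => ? [].
  under [RHS]eq_bigr do rewrite FE integral_indic_RV//.
  transitivity (\prod_(i in [set: 'I_n]%SET) P (Xs i @^-1` B i))%E; last first.
    by apply: eq_bigl => i; rewrite inE.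
  rewrite -(indep [set: 'I_n]%SET B)//.
  transitivity (\int[P]_x (\1_[set w | forall i, i \in [set: 'I_n]%SET ->
      B i (Xs i w)] x : R)%:E)%E.
    apply: eq_integral => x _; congr EFin.
    under eq_bigr do rewrite FE indicE; rewrite indicE.
    have [xB|xB] := boolP (x \in _).
      by rewrite big1// => i _; rewrite mem_set//; move: xB; rewrite inE; apply.
    have [i iB] : exists i, ~ B i (Xs i x).
      apply/existsNP => xB'; move/negP: xB; apply; rewrite inE => i _.
      exact: xB'.
    by rewrite (bigD1 i)//= memNset ?mul0r.
  rewrite integral_indic// ?setIT//.
  rewrite (_ : [set w | _] = \bigcap_i (Xs i @^-1` B i)); last first.
    apply/seteqP; split=> x xB i; first by move=> _; apply: xB; rewrite inE.
    by move=> _; apply: xB.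
  apply: fin_bigcap_measurable => // i _.
  by rewrite -[X in measurable X]setTI; exact: (measurable_funPT (Xs i)).
have [kn|nk] := ltnP k n; last first.
  by apply: IH => // i ki; have := leq_trans nk ki; rewrite leqNgt ltn_ord.
pose i := Ordinal kn.
have Fint0 j : (0 <= \int[P]_x (F j (Xs j x))%:E)%E.
  by apply: integral_ge0 => x _; rewrite lee_fin.
have Ffin j : (\int[P]_x (F j (Xs j x))%:E)%E \is a fin_num.
  by rewrite ge0_fin_numE.
pose g x := \prod_(j < n | j != i) F j (Xs j x).
pose c := \prod_(j < n | j != i) fine (\int[P]_x (F j (Xs j x))%:E)%E.
have cE : (\prod_(j < n | j != i) \int[P]_x (F j (Xs j x))%:E = c%:E)%E.
  by rewrite -prodEFin; apply: eq_bigr => j _; rewrite fineK.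
have mg : measurable_fun [set: T] g.
  rewrite /g; under eq_fun do rewrite big_mkcond/=.
  apply: measurable_prod => j _; case: (j != i); last exact: measurable_cst.
  by apply: measurableT_comp => //; exact: (measurable_funPT (Xs j)).
rewrite (bigD1 i)//= cE.
transitivity (\int[P]_x (g x * F i (Xs i x))%:E)%E.
  by apply: eq_integral => x _; rewrite (bigD1 i)//= mulrC.
rewrite muleC; apply: integral_indep => //.
- by move=> x; apply: prodr_ge0 => j _.
- move=> B mB; pose F' j := if j == i then \1_B else F j.
  have F'E x : g x * \1_B (Xs i x) = \prod_j F' j (Xs j x).
    rewrite [RHS](bigD1 i)//= {1}/F' eqxx mulrC; congr (_ * _).
    by apply: eq_bigr => j /negPf ji; rewrite /F' ji.
  under eq_integral do rewrite F'E.
  rewrite IH.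
  + rewrite (bigD1 i)//= {1}/F' eqxx integral_indic_RV// muleC; congr (_ * _)%E.
    by rewrite -cE; apply: eq_bigr => j /negPf ji; rewrite /F' ji.
  + by move=> j; rewrite /F'; case: eqP.
  + by move=> j y; rewrite /F'; case: eqP.
  + move=> j; rewrite /F'; case: eqP => // _; rewrite integral_indic_RV//.
    apply: (le_lt_trans (probability_le1 _ _)); rewrite ?ltry//.
    by rewrite -[X in measurable X]setTI; exact: (measurable_funPT (Xs j)).
  + move=> j kj; rewrite /F'; case: eqP => [_|/eqP ji]; first by exists B.
    by apply: Find; rewrite ltn_neqAle kj andbT; apply: contraNneq ji => kj';
      apply/eqP/val_inj.
Qed.

Lemma integral_same_law (i : 'I_n) (f : S -> R) : same_law X (Xs i) ->
  measurable_fun [set: S] f -> (forall y, 0 <= f y) ->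
  (\int[P]_x (f (Xs i x))%:E = \int[P0]_x (f (X x))%:E)%E.
Proof.
move=> XXs mf f0.
have mEf : measurable_fun [set: S] (EFin \o f) by exact/measurable_EFinP.
have f0' y : (0 <= (EFin \o f) y)%E by rewrite lee_fin.
rewrite -(ge0_integral_distribution (Xs i) mEf f0').
rewrite -(ge0_integral_distribution X mEf f0').
by apply: eq_measure_integral => B mB _; exact: XXs.
Qed.

Lemma chernoff (z : S -> R) (c t : R) :
  independent_copies X Xs -> measurable_fun [set: S] z ->
  (\int[P0]_x (expR (z (X x)))%:E <= (expR c)%:E)%E ->
  (P [set x | (n%:R * c + t <= \sum_i z (Xs i x))%R] <= (expR (- t))%:E)%E.
Proof.
move=> [indep law] mz zc.
have mez : measurable_fun [set: S] (fun y => expR (z y)).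
  exact: measurableT_comp.
have ez0 y : 0 <= expR (z y) by exact: expR_ge0.
have mzX i : measurable_fun [set: T] (fun x => z (Xs i x)).
  by apply: measurableT_comp => //; exact: (measurable_funPT (Xs i)).
have msum : measurable_fun [set: T] (fun x => \sum_i z (Xs i x)).
  exact: measurable_sum.
set A := [set x | _].
have intE i : (\int[P]_x (expR (z (Xs i x)))%:E =
               \int[P0]_x (expR (z (X x)))%:E)%E.
  exact: (@integral_same_law _ (fun y => expR (z y)) (law i)).
have prodE : (\int[P]_x (expR (\sum_i z (Xs i x)))%:E <= (expR (n%:R * c))%:E)%E.
  under eq_integral do rewrite expR_sum.
  rewrite (@integral_prod_indep (fun _ y => expR (z y)))//; last first.
    by move=> i; rewrite intE (le_lt_trans zc)// ltry.
  under eq_bigr do rewrite intE.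
  have int0 : (0 <= \int[P0]_x (expR (z (X x)))%:E)%E.
    by apply: integral_ge0 => x _; rewrite lee_fin.
  rewrite -(@fineK _ (\int[P0]_x (expR (z (X x)))%:E)%E); last first.
    by rewrite ge0_fin_numE// (le_lt_trans zc)// ltry.
  rewrite prodEFin lee_fin prodr_const card_ord expRM_natl lerXn2r//.
  - by rewrite nnegrE fine_ge0.
  - by rewrite nnegrE expR_ge0.
  - by rewrite -lee_fin fineK// ge0_fin_numE// (le_lt_trans zc)// ltry.
have A_E : A = [set x | (expR (n%:R * c + t) <= expR (\sum_i z (Xs i x)))%R].
  by apply/seteqP; split=> x /=; rewrite ler_expR.
have := markov_ineq (measurableT_comp (@measurable_expR R) msum) (fun=> expR_ge0 _)
  (expR_gt0 (n%:R * c + t)) prodE.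
rewrite -expRN -expRD A_E (_ : n%:R * c + - (n%:R * c + t) = - t) //.
by rewrite opprD addrA subrr sub0r.
Qed.

End chernoff.

Section expR_quadratic.
Context {R : realType}.

Let h (c x : R) : R := (1 + x + 2^-1 * x ^+ 2 + c / 2 * x ^+ 3) * expR (- x).

Let is_derive_h (c x : R) : is_derive x 1 (h c)
  (x ^+ 2 * ((3 * c - 1) / 2 - c * x / 2) * expR (- x)).
Proof. by apply: is_derive_eq; rewrite /GRing.scale /=; field. Qed.

Let continuous_h c (i : interval R) : {within [set` i], continuous (h c)}.
Proof.
apply: derivable_within_continuous => x _.
by have [] := is_derive_h c x.
Qed.

(** For [c = 0] and [x <= 0], and for [0 <= x <= 3 - c^-1], the function
[(1 + x + x ^ 2 / 2 + c x ^ 3 / 2) exp (- x)] is at least its value at 0, by the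
sign of its derivative [x ^ 2 ((3 c - 1) - c x) exp (- x) / 2]. *)
Lemma expR_quadratic_le (c K z : R) : 0 < c -> 0 <= K -> K <= 3 - c^-1 -> z <= K ->
  expR z <= 1 + z + (1 + c * K) / 2 * z ^+ 2.
Proof.
move=> c0 K0 Kc zK.
have h0 a : h a 0 = 1 by rewrite /h oppr0 expR0 !expr0n/= !mulr0 !addr0 mulr1.
have dh a x : derivable (h a) x 1 by have [] := is_derive_h a x.
have dhE a x : (h a)^`()%classic x =
    x ^+ 2 * ((3 * a - 1) / 2 - a * x / 2) * expR (- x).
  by rewrite derive1E; have [_ ->] := is_derive_h a x.
have of_h a : 1 <= h a z -> expR z <= 1 + z + 2^-1 * z ^+ 2 + a / 2 * z ^+ 3.
  by rewrite /h expRN ler_pdivlMr ?expR_gt0// mul1r.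
have [z0|z0] := leP z 0.
  have /of_h : 1 <= h 0 z.
    rewrite -(h0 0); apply: (@ler0_derive1_le_cc _ (h 0) z 0) => // [x _||].
    2,3: by rewrite in_itv/= z0 lexx.
    rewrite dhE mulr0 sub0r !mul0r subr0 mulN1r mulrN mulNr oppr_le0.
    by apply: mulr_ge0; [apply: divr_ge0; rewrite ?sqr_ge0|exact: expR_ge0].
  rewrite !mul0r addr0 => /le_trans; apply; rewrite lerD2l ler_wpM2r ?sqr_ge0//.
  by rewrite mulrDl mul1r lerDl !mulr_ge0// ltW.
have /of_h : 1 <= h c z.
  rewrite -(h0 c); apply: (@ger0_derive1_ndecr _ (h c) 0 z) => //; last exact: ltW.
  move=> x; rewrite in_itv/= => /andP[x0 xz]; rewrite dhE.
  have : x * c <= 3 * c - 1.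
    rewrite (_ : 3 * c - 1 = (3 - c^-1) * c); last first.
      by rewrite mulrBl mulVf// gt_eqF.
    by rewrite ler_pM2r// (le_trans _ Kc)// (le_trans _ zK)// ltW.
  move=> xc; apply: mulr_ge0; last exact: expR_ge0.
  by apply: mulr_ge0; [exact: sqr_ge0|lra].
move=> /le_trans; apply; rewrite -addrA lerD2l.
have : c * (z * z ^+ 2) <= c * (K * z ^+ 2).
  by rewrite ler_pM2l// ler_wpM2r// sqr_ge0.
by rewrite -exprS; lra.
Qed.

End expR_quadratic.

(** * Moments of the whitened vector *)

Section has_mean.
Context {R : realType} {d0 : measure_display} {T : measurableType d0}.
Variable P : probability T R.
Implicit Types (f g : T -> R) (a b m : R).

(** Keeps integrability and value together, so that expectations of polynomials
in the whitened vector reduce to real arithmetic. *)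
Definition has_mean f m : Prop :=
  P.-integrable [set: T] (EFin \o f) /\ ('E_P[f] = m%:E)%E.

Lemma eq_has_mean f g m : f =1 g -> has_mean f m -> has_mean g m.
Proof. by move=> /funext ->. Qed.

Lemma has_mean_cst m : has_mean (fun=> m) m.
Proof.
split; last by rewrite (expectation_cst P m).
apply/integrableP; split; first exact: measurable_cst.
by rewrite integral_cst//= probability_setT mule1 ltry.
Qed.

Lemma has_meanD f g a b : has_mean f a -> has_mean g b ->
  has_mean (fun w => f w + g w) (a + b).
Proof.
move=> [intf Ef] [intg Eg]; split; first exact: (integrableD measurableT intf intg).
move: Ef Eg; rewrite !unlock => Ef Eg.
by under eq_integral do rewrite EFinD; rewrite integralD//= Ef Eg.
Qed.

Lemma has_meanZ f a m : has_mean f m -> has_mean (fun w => a * f w) (a * m).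
Proof.
move=> [intf Ef]; split; first exact: (integrableZl measurableT a intf).
move: Ef; rewrite !unlock => Ef.
by under eq_integral do rewrite EFinM; rewrite integralZl//= Ef.
Qed.

Lemma has_mean_sum (I : Type) (s : seq I) (F : I -> T -> R) (M : I -> R) :
  (forall i, has_mean (F i) (M i)) ->
  has_mean (fun w => \sum_(i <- s) F i w) (\sum_(i <- s) M i).
Proof.
move=> FM; elim: s => [|i s IH].
  rewrite big_nil; apply: eq_has_mean (has_mean_cst 0) => w.
  by rewrite big_nil.
rewrite big_cons; apply: eq_has_mean (has_meanD (FM i) IH) => w.
by rewrite big_cons.
Qed.

Lemma has_mean_le f g a b : (forall w, f w <= g w) ->
  has_mean f a -> has_mean g b -> a <= b.
Proof.
move=> fg [intf Ef] [intg Eg]; rewrite -lee_fin -Ef -Eg unlock.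
by apply: le_integral => // w _; rewrite lee_fin.
Qed.

Lemma has_mean_ge0 f m : (forall w, 0 <= f w) -> has_mean f m -> 0 <= m.
Proof. by move=> f0; apply: has_mean_le (has_mean_cst 0). Qed.

Lemma has_mean_unique f a b : has_mean f a -> has_mean f b -> a = b.
Proof. by move=> [_ fa] [_]; rewrite fa => -[]. Qed.

Lemma ge0_has_mean f m : measurable_fun [set: T] f -> (forall w, 0 <= f w) ->
  ('E_P[f] <= m%:E)%E -> exists2 a, has_mean f a & a <= m.
Proof.
move=> mf f0 fm; have Ef0 : (0 <= 'E_P[f])%E by exact: expectation_ge0.
have Efin : ('E_P[f] \is a fin_num)%E.
  by rewrite ge0_fin_numE// (le_lt_trans fm)// ltry.
exists (fine ('E_P[f])%E); last by rewrite -lee_fin fineK.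
split; last by rewrite fineK.
apply/integrableP; split; first exact/measurable_EFinP.
under eq_integral do rewrite /= ger0_norm//.
by move: fm; rewrite unlock => fm; rewrite (le_lt_trans fm)// ltry.
Qed.

Lemma dominated_has_mean f g m : measurable_fun [set: T] f ->
  (forall w, `|f w| <= g w) -> has_mean g m -> exists a, has_mean f a.
Proof.
move=> mf fg [intg Eg].
have intf : P.-integrable [set: T] (EFin \o f).
  apply: (le_integrable measurableT _ _ intg); first exact/measurable_EFinP.
  by move=> w _ /=; rewrite lee_fin (le_trans (fg w))// ler_norm.
exists (fine ('E_P[f])%E); split=> //; rewrite fineK// unlock.
exact: integrable_fin_num.
Qed.

Lemma has_mean_expectation_le f g m : measurable_fun [set: T] f ->
  (forall w, 0 <= f w) -> (forall w, f w <= g w) -> has_mean g m ->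
  ('E_P[f] <= m%:E)%E.
Proof.
move=> mf f0 fg gm.
have [a fa] : exists a, has_mean f a.
  by apply: dominated_has_mean gm => // w; rewrite ger0_norm.
by have [_ ->] := fa; rewrite lee_fin; apply: has_mean_le fg fa gm.
Qed.

End has_mean.

Section second_moments.
Context {R : realType} {d : nat} {d0 : measure_display}.
Context {T : measurableType d0} {P : probability T R}.
Variable X : {RV P >-> d.-tuple R}.
Implicit Types u v theta : 'cV[R]_d.

Lemma measurable_inner u :
  measurable_fun [set: d.-tuple R] (fun x => inner u (vec x)).
Proof.
apply: measurable_sum => j; under eq_fun do rewrite mxE.
by apply: measurable_funM; [exact: measurable_cst|exact: measurable_tnth].
Qed.

Lemma measurable_innerX u : measurable_fun [set: T] (fun w => inner u (vec (X w))).
Proof.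
by apply: (measurableT_comp (measurable_inner u)); exact: (measurable_funPT X).
Qed.

Hypothesis X2 : square_integrable X.

Lemma has_mean_coord (i j : 'I_d) :
  has_mean P (fun w => tnth (X w) i * tnth (X w) j) (gram X i j).
Proof.
have mX k : measurable_fun [set: T] (fun w => tnth (X w) k).
  apply: (measurableT_comp (measurable_tnth k)); exact: (measurable_funPT X).
have sqX k : exists m, has_mean P (fun w => tnth (X w) k ^+ 2) m.
  have m2 : measurable_fun [set: T] (fun w => tnth (X w) k ^+ 2).
    exact: measurable_funX.
  have pos w : 0 <= tnth (X w) k ^+ 2 by exact: sqr_ge0.
  have fin : ('E_P[fun w => (tnth (X w) k ^+ 2)%R] \is a fin_num)%E.
    by rewrite ge0_fin_numE ?X2// expectation_ge0.
  have [|m mE _] := @ge0_has_mean _ _ _ P _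
     (fine ('E_P[fun w => (tnth (X w) k ^+ 2)%R])%E) m2 pos; last by exists m.
  by rewrite fineK.
have [a Ha] := sqX i; have [b Hb] := sqX j.
have [m Hm] : exists m, has_mean P (fun w => tnth (X w) i * tnth (X w) j) m.
  apply: (dominated_has_mean _ _ (has_meanD Ha Hb)).
    exact: measurable_funM.
  move=> w; rewrite normrM -(real_normK (num_real (tnth (X w) i))).
  rewrite -(real_normK (num_real (tnth (X w) j))).
  by nra.
by rewrite mxE; have [_ ->] := Hm.
Qed.

Lemma innerE_sum u v : inner u v * inner u v =
  \sum_i \sum_j (u i 0 * u j 0) * (v i 0 * v j 0).
Proof.
rewrite /inner big_distrl; apply: eq_bigr => i _; rewrite big_distrr.
by apply: eq_bigr => j _; rewrite mulrACA.
Qed.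

Lemma inner_mulmxE u (A : 'M[R]_d) :
  inner u (A *m u) = \sum_i \sum_j (u i 0 * u j 0) * A i j.
Proof.
apply: eq_bigr => i _; rewrite mxE mulr_sumr; apply: eq_bigr => j _.
by rewrite [A i j * _]mulrC mulrA.
Qed.

Lemma has_mean_energy theta :
  has_mean P (fun w => inner theta (vec (X w)) ^+ 2)
             (inner theta (gram X *m theta)).
Proof.
rewrite inner_mulmxE; apply: (@eq_has_mean _ _ _ _ (fun w =>
  \sum_i \sum_j (theta i 0 * theta j 0) * (tnth (X w) i * tnth (X w) j))).
  move=> w; rewrite expr2 innerE_sum; apply: eq_bigr => i _.
  by apply: eq_bigr => j _; rewrite !mxE.
apply: has_mean_sum => i; apply: has_mean_sum => j.
exact/has_meanZ/has_mean_coord.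
Qed.

Lemma energyE theta : energy X theta = (inner theta (gram X *m theta))%:E.
Proof. by have [] := has_mean_energy theta. Qed.

Lemma psd_gram : psd (gram X).
Proof.
split=> [|u].
  apply/matrixP => i j; rewrite !mxE; congr (fine ('E_P[_])%E).
  by apply/funext => w; rewrite mulrC.
by apply: has_mean_ge0 (has_mean_energy u) => w; exact: sqr_ge0.
Qed.

Section fourth_moments.
Variable kappa : R.
Hypothesis kappa_gt0 : 0 < kappa.
Hypothesis X4 : (ereal_sup [set fourth_moment X theta
  | theta in [set theta : 'cV[R]_d | (energy X theta <= 1)%E]] <= kappa%:E)%E.

Let fourth_le u : inner u (gram X *m u) <= 1 ->
  exists2 m, has_mean P (fun w => inner u (vec (X w)) ^+ 4) m & m <= kappa.
Proof.
move=> u1; apply: ge0_has_mean.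
- by apply: measurable_funX; exact: measurable_innerX.
- by move=> w; rewrite (exprM _ 2 2) sqr_ge0.
- apply: (le_trans _ X4); apply: ereal_sup_ubound; exists u => //=.
  by rewrite energyE lee_fin.
Qed.

(** The hypothesis bounds the kurtosis; in a direction without energy it forces
the fourth moment to vanish, because such a direction can be scaled at will. *)
Lemma has_mean_fourth u :
  exists2 m, has_mean P (fun w => inner u (vec (X w)) ^+ 4) m &
             m <= kappa * inner u (gram X *m u) ^+ 2.
Proof.
have [_ /(_ u)] := psd_gram; set N := inner u _ => N0.
have scale c : 0 < c -> c ^+ 2 * N <= 1 ->
    exists2 m, has_mean P (fun w => inner u (vec (X w)) ^+ 4) m &
               m <= kappa * (c ^- 4).
  move=> c0 cN; have [|m Hm mk] := @fourth_le (c *: u).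
    by rewrite -scalemxAr innerZl innerZr mulrA -expr2.
  have c4 : c ^+ 4 != 0 by rewrite expf_neq0// gt_eqF.
  exists (c ^- 4 * m); last by rewrite mulrC ler_wpM2r// invr_ge0 exprn_ge0// ltW.
  apply: eq_has_mean (has_meanZ (c ^- 4) Hm) => w.
  by rewrite innerZl exprMn mulrA mulVf// mul1r.
have [N00|Nn0] := eqVneq N 0.
  have [|m Hm _] := scale 1 ltr01; first by rewrite N00 mulr0.
  exists m => //; rewrite N00 expr0n mulr0; apply/ler_addgt0Pl => e e0.
  rewrite addr0; pose c := Num.sqrt (Num.sqrt (kappa / e)).
  have ke : 0 < kappa / e by rewrite divr_gt0.
  have c0 : 0 < c by rewrite !sqrtr_gt0.
  have c4 : c ^+ 4 = kappa / e.
    by rewrite (exprM _ 2 2) sqr_sqrtr ?sqrtr_ge0// sqr_sqrtr// ltW.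
  have [|m' Hm' m'e] := scale c c0; first by rewrite N00 mulr0.
  rewrite (has_mean_unique Hm Hm') (le_trans m'e)// c4 invf_div mulrA.
  by rewrite mulrAC mulrV ?mul1r// unitfE gt_eqF.
have N_gt0 : 0 < N by rewrite lt_neqAle eq_sym Nn0.
have [||m Hm mk] := scale (Num.sqrt N)^-1.
- by rewrite invr_gt0 sqrtr_gt0.
- by rewrite exprVn sqr_sqrtr// mulVf.
exists m => //; rewrite (le_trans mk)// exprVn invrK (exprM _ 2 2).
by rewrite sqr_sqrtr.
Qed.

End fourth_moments.

End second_moments.

Section cauchy_schwarz.
Context {R : realType} {d : nat}.
Implicit Types u v : 'cV[R]_d.

Lemma inner_eq0 u : inner u u = 0 -> u = 0.
Proof.
move=> u0; apply/colP => j; rewrite mxE.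
have /psumr_eq0P/(_ j isT) := u0; rewrite -expr2 => H.
by apply/eqP; rewrite -sqrf_eq0 H// => i _; rewrite -expr2 sqr_ge0.
Qed.

Lemma cauchy_schwarz u v : inner u v ^+ 2 <= inner u u * inner v v.
Proof.
set a := inner v v; set b := inner u v.
have [a0|a_neq0] := eqVneq a 0.
  have v0 : v = 0 by exact: inner_eq0.
  rewrite a0 /b v0 mulr0 /inner big1 ?expr0n// => j _.
  by rewrite mxE mulr0.
have a_gt0 : 0 < a by rewrite lt_neqAle eq_sym a_neq0 inner_ge0.
have := inner_ge0 (a *: u + (- b) *: v).
rewrite innerDl !innerDr !innerZl !innerZr (innerC v u) -/a -/b => H.
have : 0 <= a * (inner u u * a - b ^+ 2) by nra.
by rewrite pmulr_rge0// subr_ge0.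
Qed.

Lemma sum_sqr_le (a : 'I_d -> R) :
  (\sum_j a j) ^+ 2 <= d%:R * \sum_j a j ^+ 2.
Proof.
have := cauchy_schwarz (\col_j a j) (\col__ 1); rewrite /inner.
under eq_bigr do rewrite !mxE mulr1.
under [X in _ <= X * _]eq_bigr do rewrite !mxE -expr2.
under [X in _ <= _ * X]eq_bigr do rewrite !mxE mulr1.
by rewrite sumr_const card_ord [leRHS]mulrC.
Qed.

Lemma inner_perturb_le u v (t : R) : 0 <= t -> inner u u <= 1 ->
  inner v v <= t ^+ 2 -> `|inner u v| <= t.
Proof.
move=> t0 u1 vt; rewrite -(@ler_pXn2r _ 2)// ?nnegrE// real_normK ?num_real//.
rewrite (le_trans (cauchy_schwarz u v))//.
by rewrite -[leRHS]mul1r ler_pM ?inner_ge0.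
Qed.

Lemma inner_delta_mulmx (A : 'M[R]_d) (j : 'I_d) :
  inner (delta_mx j 0) (A *m delta_mx j 0) = A j j.
Proof.
rewrite inner_delta mxE (bigD1 j)//= !mxE !eqxx mulr1 big1 ?addr0// => i ij.
by rewrite !mxE (negPf ij) mulr0.
Qed.

End cauchy_schwarz.

Section whitening.
Context {R : realType} {d : nat}.
Implicit Types (G : 'M[R]_d) (u v x theta : 'cV[R]_d).

Definition whitening G : 'M[R]_d := sym_sqrt (pseudo_inverse G).

(** The covariance of the whitened vector: the orthogonal projection onto the
image of [G] (the identity when [G] is invertible). *)
Definition white_proj G : 'M[R]_d := whitening G *m G *m whitening G.

(** [theta] in whitened coordinates, where the energy is the squared norm. *)
Definition white_coord G theta : 'cV[R]_d := whitening G *m (G *m theta).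

Variable G : 'M[R]_d.
Hypothesis psdG : psd G.
Let W := whitening G.
Let Gp := pseudo_inverse G.

Lemma trmx_whitening : W^T = W.
Proof.
by have [_ psdGp] := pseudo_inverseP psdG; have [[]] := sym_sqrtP psdGp.
Qed.

Let WW : W *m W = Gp.
Proof. by have [_ psdGp] := pseudo_inverseP psdG; have [] := sym_sqrtP psdGp. Qed.

Let GpE n (A : 'M[R]_(d, n)) : G *m (Gp *m (G *m A)) = G *m A.
Proof. by have [[GGG _ _ _] _] := pseudo_inverseP psdG; rewrite !mulmxA GGG. Qed.

Let WWE n (A : 'M[R]_(d, n)) : W *m (W *m A) = Gp *m A.
Proof. by rewrite mulmxA WW. Qed.

Let symG : G^T = G. Proof. by case: psdG. Qed.

Lemma white_proj_sym : (white_proj G)^T = white_proj G.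
Proof. by rewrite /white_proj !trmx_mul trmx_whitening symG mulmxA. Qed.

Lemma white_proj_idem : white_proj G *m white_proj G = white_proj G.
Proof.
by rewrite /white_proj -/W -!mulmxA WWE GpE.
Qed.

Lemma white_projE u : inner u (white_proj G *m u) =
  inner (W *m u) (G *m (W *m u)).
Proof. by rewrite inner_mulmx trmx_whitening /white_proj !mulmxA. Qed.

Lemma white_proj_coord theta :
  white_proj G *m white_coord G theta = white_coord G theta.
Proof.
by rewrite /white_proj /white_coord -/W -!mulmxA WWE GpE.
Qed.

Lemma inner_white_coord theta :
  inner (white_coord G theta) (white_coord G theta) = inner theta (G *m theta).
Proof.
rewrite {1}/white_coord inner_mulmx trmx_whitening /white_coord -/W WWE.
by rewrite inner_mulmx symG GpE.
Qed.

Lemma inner_white_coord_whitening theta x :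
  inner (white_coord G theta) (W *m x) = inner theta (G *m (Gp *m x)).
Proof.
by rewrite /white_coord inner_mulmx trmx_whitening WWE inner_mulmx symG.
Qed.

Lemma inner_white_proj_le u : inner u (white_proj G *m u) <= inner u u.
Proof.
have := inner_ge0 (u - white_proj G *m u).
have E : inner (white_proj G *m u) (white_proj G *m u) =
         inner u (white_proj G *m u).
  by rewrite inner_mulmx white_proj_sym mulmxA white_proj_idem.
rewrite -scaleN1r innerDl !innerDr !innerZl !innerZr E.
by rewrite (innerC _ u); lra.
Qed.

Lemma inner_white_proj_ge0 u : 0 <= inner u (white_proj G *m u).
Proof. by rewrite white_projE; case: psdG. Qed.

Lemma white_proj_diag (j : 'I_d) : 0 <= white_proj G j j <= 1.
Proof.
rewrite -inner_delta_mulmx inner_white_proj_ge0/=.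
have d1 : inner (delta_mx j 0) (delta_mx j 0) = 1 :> R.
  by rewrite inner_delta mxE !eqxx.
by rewrite -d1 inner_white_proj_le.
Qed.

Lemma white_proj_trace : 0 <= \tr (white_proj G) <= d%:R.
Proof.
apply/andP; split; first by apply: sumr_ge0 => j _; case/andP: (white_proj_diag j).
rewrite -[leRHS]mulr1 -[d in leRHS]card_ord mulr_natl -sumr_const.
by apply: ler_sum => j _; case/andP: (white_proj_diag j).
Qed.

(** With [z = v - u], the first order term of the energy of [v] is
[2 * inner u z], because the projection fixes [u], and the second order term is
at most [inner z z]. *)
Lemma white_proj_perturb u v (t : R) : 0 <= t -> inner u u = 1 ->
  white_proj G *m u = u -> inner (v - u) (v - u) <= t ^+ 2 ->
  - (2 * t) <= inner v (white_proj G *m v) - 1 <= 2 * t + t ^+ 2 /\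
  inner v v <= (1 + t) ^+ 2.
Proof.
move=> t0 u1 Pu; have vE : v = u + (v - u) by rewrite addrC subrK.
move: (v - u) vE => z ->{v} vut.
have uz : `|inner u z| <= t by apply: inner_perturb_le => //; rewrite u1.
have uPz : inner u (white_proj G *m z) = inner u z.
  by rewrite -[in LHS]Pu inner_mulmx white_proj_sym mulmxA white_proj_idem
    -{1}white_proj_sym -inner_mulmx Pu.
have zP0 := inner_white_proj_ge0 z.
have zP1 : inner z (white_proj G *m z) <= t ^+ 2.
  exact: le_trans (inner_white_proj_le z) vut.
move: uz; rewrite ler_norml => /andP[uz1 uz2].
split.
  rewrite mulmxDr Pu innerDl !innerDr u1 uPz (innerC z u).
  by apply/andP; split; lra.
rewrite innerDl !innerDr u1 (innerC z u); nra.
Qed.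

End whitening.

Section whitened_moments.
Context {R : realType} {d : nat} {d0 : measure_display}.
Context {T : measurableType d0} {P : probability T R}.
Variable X : {RV P >-> d.-tuple R}.
Variable kappa : R.
Hypotheses (X2 : square_integrable X) (kappa_gt0 : 0 < kappa).
Hypothesis X4 : (ereal_sup [set fourth_moment X theta
  | theta in [set theta : 'cV[R]_d | (energy X theta <= 1)%E]] <= kappa%:E)%E.

Let G := gram X.
Let psdG : psd G := psd_gram X2.

Definition white (x : d.-tuple R) : 'cV[R]_d := whitening G *m vec x.

Lemma inner_white u x : inner u (white x) = inner (whitening G *m u) (vec x).
Proof. by rewrite inner_mulmx trmx_whitening. Qed.

Lemma measurable_inner_white u :
  measurable_fun [set: d.-tuple R] (fun x => inner u (white x)).
Proof. by under eq_fun do rewrite inner_white; exact: measurable_inner. Qed.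

Lemma inner_white_white x : inner (white x) (white x) =
  \sum_j inner (delta_mx j 0) (white x) ^+ 2.
Proof. by apply: eq_bigr => j _; rewrite inner_delta expr2. Qed.

Lemma measurable_white_sqr :
  measurable_fun [set: d.-tuple R] (fun x => inner (white x) (white x)).
Proof.
under eq_fun do rewrite inner_white_white.
by apply: measurable_sum => j; apply: measurable_funX; exact: measurable_inner_white.
Qed.

Lemma has_mean_white2 u :
  has_mean P (fun w => inner u (white (X w)) ^+ 2) (inner u (white_proj G *m u)).
Proof.
rewrite (white_projE psdG).
apply: eq_has_mean (has_mean_energy X2 (whitening G *m u)) => w.
by rewrite inner_white.
Qed.

Lemma has_mean_white4 u :
  exists2 m, has_mean P (fun w => inner u (white (X w)) ^+ 4) m &
             m <= kappa * inner u (white_proj G *m u) ^+ 2.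
Proof.
rewrite (white_projE psdG).
have [m Hm mk] := has_mean_fourth X2 kappa_gt0 X4 (whitening G *m u).
by exists m => //; apply: eq_has_mean Hm => w; rewrite inner_white.
Qed.

Lemma has_mean_white_norm2 :
  has_mean P (fun w => inner (white (X w)) (white (X w))) (\tr (white_proj G)).
Proof.
apply: (@eq_has_mean _ _ _ _
    (fun w => \sum_j inner (delta_mx j 0) (white (X w)) ^+ 2)).
  by move=> w; rewrite inner_white_white.
by apply: has_mean_sum => j; rewrite -inner_delta_mulmx; exact: has_mean_white2.
Qed.

Lemma has_mean_white_norm4 :
  exists2 m, has_mean P (fun w => inner (white (X w)) (white (X w)) ^+ 2) m &
             m <= kappa * d%:R ^+ 2.
Proof.
have H4 j := cid2 (has_mean_white4 (delta_mx j 0)).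
have HS := has_meanZ d%:R (has_mean_sum (index_enum 'I_d) (fun j => s2valP (H4 j))).
have mS : measurable_fun [set: T] (fun w => inner (white (X w)) (white (X w))).
  by apply: (measurableT_comp measurable_white_sqr); exact: (measurable_funPT X).
apply: ge0_has_mean => [|w|].
- exact: measurable_funX.
- exact: sqr_ge0.
- apply: (le_trans (has_mean_expectation_le _ _ _ HS)).
  + exact: measurable_funX.
  + by move=> w; exact: sqr_ge0.
  + move=> w; rewrite inner_white_white (le_trans (sum_sqr_le _))//.
    by rewrite le_eqVlt; under eq_bigr do rewrite -exprM; rewrite eqxx.
  rewrite lee_fin expr2 mulrCA ler_wpM2l// -[d in leRHS]card_ord.
  rewrite mulr_natr -sumr_const; apply: ler_sum => j _.
  case: (H4 j) => m /= _ mk; rewrite (le_trans mk)// -[leRHS]mulr1.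
  rewrite (ler_wpM2l (ltW kappa_gt0))// inner_delta_mulmx.
  by have /andP[? ?] := white_proj_diag psdG j; rewrite exprn_ile1.
Qed.

(** Exponential moments are bounded through polynomials of degree four. Their
quadratic monomials have a known expectation, while the quartic ones are only
bounded from above: hence the signs imposed on [c2] and [c4]. *)
Lemma expectation_white_le u (f : T -> R) (c0 c1 c2 c3 c4 : R) :
  measurable_fun [set: T] f -> (forall w, 0 <= f w) -> 0 <= c2 -> 0 <= c4 ->
  (forall w, let S := inner (white (X w)) (white (X w)) in
    let x := inner u (white (X w)) in
    f w <= c0 + c1 * S + c2 * S ^+ 2 + c3 * x ^+ 2 + c4 * x ^+ 4) ->
  (\int[P]_w (f w)%:E <= (c0 + c1 * \tr (white_proj G) + c2 * (kappa * d%:R ^+ 2)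
    + c3 * inner u (white_proj G *m u)
    + c4 * (kappa * inner u (white_proj G *m u) ^+ 2))%:E)%E.
Proof.
move=> mf f0 c20 c40 fle.
have [m4 H4 m4le] := has_mean_white4 u.
have [s4 HS4 s4le] := has_mean_white_norm4.
have H := has_meanD (has_meanD (has_meanD (has_meanD (has_mean_cst P c0)
  (has_meanZ c1 has_mean_white_norm2)) (has_meanZ c2 HS4))
  (has_meanZ c3 (has_mean_white2 u))) (has_meanZ c4 H4).
have := has_mean_expectation_le mf f0 fle H; rewrite unlock => /le_trans; apply.
by rewrite lee_fin; apply: lerD; [do 2![apply: lerD => //]|]; exact: ler_wpM2l.
Qed.

End whitened_moments.

(** * Deviations over a grid *)

Section moment_rounding.
Context {R : realType} {d n : nat}.
Implicit Types (u y : 'cV[R]_d).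

Lemma inner_suml (I : Type) (r : seq I) (F : I -> 'cV[R]_d) u :
  inner (\sum_(i <- r) F i) u = \sum_(i <- r) inner (F i) u.
Proof.
elim: r => [|i r IH]; last by rewrite !big_cons innerDl IH.
by rewrite !big_nil /inner big1// => j _; rewrite mxE mul0r.
Qed.

(** Here [c] weighs the sample points [y], and [s *: Q] stands for a multiple of
their covariance, with the opposite sign. *)
Lemma moment_rounding (h s : R) (c : 'I_n -> R) (y : 'I_n -> 'cV[R]_d)
    (Q : 'M[R]_d) u : 0 < h -> exists k : 'I_d -> int,
  let w := \col_j (h * (k j)%:~R) in
  inner (w - u) (w - u) <= d%:R * (3 / 2 * h) ^+ 2 /\
  \sum_i c i * inner w (y i) ^+ 2 + s * inner w (Q *m w) <=
  \sum_i c i * inner u (y i) ^+ 2 + s * inner u (Q *m u)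
    + h ^+ 2 / 4 * (\sum_i c i * inner (y i) (y i) + s * \tr Q).
Proof.
move=> h0; pose A := \sum_i c i *: (y i *m (y i)^T) + s *: Q.
have yyE v i : inner v ((y i *m (y i)^T) *m v) = inner v (y i) ^+ 2.
  rewrite -mulmxA (mx11_scalar ((y i)^T *m v)) -innerE mul_mx_scalar innerZr.
  by rewrite (innerC (y i)) expr2.
have AE v : inner v (A *m v) =
    \sum_i c i * inner v (y i) ^+ 2 + s * inner v (Q *m v).
  rewrite mulmxDl innerDr -scalemxAl innerZr; congr (_ + _).
  rewrite mulmx_suml innerC inner_suml; apply: eq_bigr => i _.
  by rewrite -scalemxAl innerZl innerC yyE.
have trA : \tr A = \sum_i c i * inner (y i) (y i) + s * \tr Q.
  rewrite linearD linearZ /= linear_sum; congr (_ + _); apply: eq_bigr => i _.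
  rewrite linearZ /=; congr (_ * _).
  by rewrite mxtrace_mulC innerE /mxtrace big_ord1.
have [k [ku kA]] := grid_rounding A u h0; exists k => w.
split; last by rewrite -!AE -trA.
rewrite -[d in leRHS]card_ord mulr_natl -sumr_const; apply: ler_sum => j _.
rewrite -expr2 !mxE; have := ku j; rewrite !mxE => kuj.
rewrite -(real_normK (num_real (_ + _))) lerXn2r// nnegrE//.
by rewrite mulr_ge0// ltW.
Qed.

End moment_rounding.

Section union_bound.
Context {R : realType} {d0 : measure_display} {T : measurableType d0}.
Variable P : probability T R.

Lemma union_bound (I : finType) (N : {pred I}) (B : I -> set T) (e : R) :
  (forall a, measurable (B a)) -> (forall a, a \in N -> (P (B a) <= e%:E)%E) ->
  measurable (\bigcup_(a in [set` N]) B a) /\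
  (P (\bigcup_(a in [set` N]) B a) <= (#|N|%:R * e)%:E)%E.
Proof.
move=> mB PB; rewrite bigcup_pred.
rewrite mulr_natl -sumr_const -sumEFin.
elim/big_ind2 : _ => [|A a A' a' [mA PA] [mA' PA']|a aN].
- by rewrite measure0.
- split; first exact: measurableU.
  by rewrite (le_trans (measureU2 _ _ _))// leeD.
- by split=> //; exact: PB.
Qed.

End union_bound.

(** Bounds the logarithm of the number of grid points of mesh [h] in a ball,
where [rho] is the ratio of its radius to [h * Num.sqrt d]. *)
Definition entropy {R : realType} (d : nat) (rho : R) : R :=
  d%:R * (1 + ln (2 * (1 + rho))).

Section grid_deviation.
Context {R : realType} {d n : nat} {d0 d1 : measure_display}.
Context {T0 : measurableType d0} {T : measurableType d1}.
Context {P0 : probability T0 R} {P : probability T R}.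
Variables (X : {RV P0 >-> d.-tuple R}) (Xs : 'I_n -> {RV P >-> d.-tuple R}).
Hypothesis copies : independent_copies X Xs.

Lemma sum_norm_le (h rho b : R) (a : 'I_d -> R) : 0 < h -> 0 <= rho ->
  d%:R * b <= (rho * d%:R * h) ^+ 2 -> \sum_j (h * a j) ^+ 2 <= b ->
  \sum_j `|a j| <= rho * d%:R.
Proof.
move=> h0 rho0 brho ab.
rewrite -(@ler_pXn2r _ 2)// ?nnegrE ?mulr_ge0 ?sumr_ge0//.
rewrite (le_trans (sum_sqr_le _))//.
rewrite -(@ler_pM2l _ (h ^+ 2)) ?exprn_gt0//.
rewrite mulrCA mulr_sumr -[leRHS]exprMn [h * _]mulrC (le_trans _ brho)//.
rewrite ler_wpM2l// (le_trans _ ab)// le_eqVlt; apply/orP; left; apply/eqP.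
by apply: eq_bigr => j _; rewrite real_normK ?num_real// exprMn.
Qed.

(** Chernoff's bound at each grid point of [D], with their number paid by
[entropy]; the predicate [D] restricts the grid to the points where the
exponential moment of [z] is under control. *)
Lemma grid_deviation (h rho b eps : R) (D : set 'cV[R]_d)
    (z : 'cV[R]_d -> d.-tuple R -> R) (c : 'cV[R]_d -> R) :
  0 < h -> 0 < rho -> 0 < eps -> d%:R * b <= (rho * d%:R * h) ^+ 2 ->
  (forall u, D u -> inner u u <= b) ->
  (forall u, D u -> measurable_fun [set: d.-tuple R] (z u)) ->
  (forall u, D u -> \int[P0]_w (expR (z u (X w)))%:E <= (expR (c u))%:E)%E ->
  exists A : set T, [/\ measurable A, (P (~` A) <= eps%:E)%E &
    forall w, A w -> forall k : 'I_d -> int, let u := \col_j (h * (k j)%:~R) in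
      D u -> \sum_i z u (Xs i w) < n%:R * c u + (entropy d rho + ln eps^-1)].
Proof.
move=> h0 rho0 eps0 brho Db mz zc.
pose m := (Num.truncn (rho * d%:R)).+1.
have m_gt : rho * d%:R < m%:R by rewrite truncnS_gt.
pose N := [set c : {ffun 'I_d -> bool * 'I_m} |
      \sum_j `|signed_nat (c j) : R| <= rho * d%:R]%SET.
have cardN : #|N|%:R <= expR (entropy d rho) by exact: grid_count.
pose pt (c : {ffun 'I_d -> bool * 'I_m}) : 'cV[R]_d := \col_j (h * signed_nat (c j)).
pose t := entropy d rho + ln eps^-1.
pose B a : set T := [set w | D (pt a) /\
  n%:R * c (pt a) + t <= \sum_i z (pt a) (Xs i w)].
have mB a : measurable (B a).
  have [Da|nDa] := pselect (D (pt a)); last first.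
    by rewrite (_ : B a = set0)//; apply/seteqP; split=> // w [].
  rewrite (_ : B a = [set: T] `&`
      [set w | n%:R * c (pt a) + t <= \sum_i z (pt a) (Xs i w)]).
    apply: measurable_fun_le => //.
    apply: measurable_sum => i; apply: (measurableT_comp (mz _ Da)).
    exact: (measurable_funPT (Xs i)).
  by apply/seteqP; split=> w; rewrite /B /= => -[].
have PB a : (P (B a) <= (expR (- t))%:E)%E.
  have [Da|nDa] := pselect (D (pt a)); last first.
    rewrite (_ : B a = set0) ?measure0 ?lee_fin ?expR_ge0//.
    by apply/seteqP; split=> // w [].
  apply: (le_trans _ (chernoff t copies (mz _ Da) (zc _ Da))).
  apply: le_measure; rewrite ?inE//; last by move=> w [].
  rewrite -[X in measurable X]setTI.
  apply: measurable_fun_le => //.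
  apply: measurable_sum => i; apply: (measurableT_comp (mz _ Da)).
  exact: (measurable_funPT (Xs i)).
have [mU PU] := union_bound mB (fun a (_ : a \in N) => PB a).
exists (~` \bigcup_(a in [set` N]) B a); split.
- exact: measurableC.
- rewrite setCK (le_trans PU)// lee_fin /t opprD expRD lnV ?posrE//.
  rewrite opprK lnK ?posrE// mulrA -[leRHS]mul1r ler_pM2r//.
  by rewrite expRN ler_pdivrMr ?expR_gt0// mul1r.
- move=> w Aw k u Du.
  have kE j : u j 0 = h * (k j)%:~R by rewrite mxE.
  have ksum : \sum_j `|(k j)%:~R : R| <= rho * d%:R.
    apply: (sum_norm_le h0 (ltW rho0) brho); apply: le_trans (Db _ Du).
    rewrite le_eqVlt; apply/orP; left; apply/eqP.
    by apply: eq_bigr => j _; rewrite -kE expr2.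
  have km j : (`|k j| < m)%N.
    rewrite -(ltr_nat R) (le_lt_trans _ m_gt)// (le_trans _ ksum)//.
    rewrite (bigD1 j)//= natr_absz intr_norm lerDl sumr_ge0//.
  pose a : {ffun 'I_d -> bool * 'I_m} := [ffun j => (k j < 0, Ordinal (km j))].
  have aE j : signed_nat (a j) = (k j)%:~R :> R.
    rewrite /signed_nat ffunE /= natr_absz; have [k0|k0] := ltrP (k j) 0.
      by rewrite expr1 mulN1r ltr0_norm// rmorphN opprK.
    by rewrite expr0 mul1r ger0_norm.
  have ua : u = pt a by apply/colP => j; rewrite !mxE aE.
  have aN : a \in N by rewrite /N inE; under eq_bigr do rewrite aE.
  rewrite ltNge; apply/negP => le_z; apply: Aw; exists a => //.
  by split; rewrite -ua.
Qed.

End grid_deviation.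

(** * Exponential moments of the excess *)

Ltac nonneg := repeat first [ done | exact: sqr_ge0 | by apply: ltW
  | rewrite invr_ge0 | apply: mulr_ge0 | apply: addr_ge0 ].

(** Bounds the second moment of [excess v u] below when the energy of [u] is
within [a] of 1. Its value [kappa - 1] at [a = v = 0] is what the leading term
of [mu_] retains. *)
Definition variance_bound {R : realType} (d : nat) (kappa v a : R) : R :=
  (kappa - 1) * (1 + 2 * a) + kappa * a ^+ 2 + kappa * (v * d%:R) ^+ 2
  + 2 * v * d%:R.

Section exponential_moments.
Context {R : realType} {d : nat} {d0 : measure_display}.
Context {T : measurableType d0} {P : probability T R}.
Variable X : {RV P >-> d.-tuple R}.
Variable kappa : R.
Hypotheses (X2 : square_integrable X) (kappa_gt1 : 1 < kappa).
Hypothesis X4 : (ereal_sup [set fourth_moment X theta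
  | theta in [set theta : 'cV[R]_d | (energy X theta <= 1)%E]] <= kappa%:E)%E.

Let kappa_gt0 : 0 < kappa := lt_trans ltr01 kappa_gt1.
Let Q := white_proj (gram X).
Let r := \tr Q.
Let psdG := psd_gram X2.

(** The term in [v] compensates the inflation due to the rounding of a direction
to the grid point [u], when [v] is the variance of the rounding. *)
Definition excess (v : R) (u : 'cV[R]_d) (x : d.-tuple R) : R :=
  inner u (white X x) ^+ 2 - v * inner (white X x) (white X x) - 1.

(** Cutting a variable from above at a nonnegative level increases neither its
mean nor its second moment, so that no bias has to be accounted for. *)
Definition truncated_excess (lam v K : R) u x := Num.min (lam * excess v u x) K.

(** The points of large norm are treated as if they were 0, which can only lower
the empirical energy; otherwise the term in [v] of the excess would be unbounded. *)
Definition truncated_defect (lam v M : R) u x :=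
  if inner (white X x) (white X x) <= M then - (lam * excess v u x) else lam.

Lemma measurable_excess v u : measurable_fun [set: d.-tuple R] (excess v u).
Proof.
apply: measurable_funB; last exact: measurable_cst.
apply: measurable_funB.
  by apply: measurable_funX; exact: measurable_inner_white.
by apply: measurable_funM => //; exact: measurable_white_sqr.
Qed.

Lemma measurable_truncated_excess lam v K u :
  measurable_fun [set: d.-tuple R] (truncated_excess lam v K u).
Proof.
apply: measurable_minr => //.
by apply: measurable_funM => //; exact: measurable_excess.
Qed.

Lemma measurable_truncated_defect lam v M u :
  measurable_fun [set: d.-tuple R] (truncated_defect lam v M u).
Proof.
apply: measurable_fun_ifT => //.
  by apply: measurable_fun_ler => //; exact: measurable_white_sqr.
apply: measurable_funN.
by apply: measurable_funM => //; exact: measurable_excess.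
Qed.

Let variance_le (v a N : R) : 0 <= v -> `|N - 1| <= a ->
  1 + 2 * v * r + v ^+ 2 * (kappa * d%:R ^+ 2) - 2 * N + kappa * N ^+ 2
  <= variance_bound d kappa v a.
Proof.
move=> v0; rewrite ler_norml => /andP[aN Na]; rewrite /variance_bound.
have /andP[_ rd] : 0 <= r <= d%:R := white_proj_trace psdG.
have vr : v * r <= v * d%:R by rewrite ler_wpM2l.
have aN2 : (N - 1) ^+ 2 <= a ^+ 2.
  by rewrite -ler_sqrt ?sqr_ge0// !sqrtr_sqr ler_norml (ger0_norm (_ : 0 <= a));
    lra.
have k1 : (kappa - 1) * (N - 1) <= (kappa - 1) * a.
  by rewrite ler_wpM2l// subr_ge0 ltW.
have k2 : kappa * (N - 1) ^+ 2 <= kappa * a ^+ 2 by rewrite ler_wpM2l// ltW.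
by nra.
Qed.

Lemma mgf_excess (lam v K c a : R) u : 0 <= lam -> 0 <= v -> 0 < c -> 0 <= K ->
  K <= 3 - c^-1 -> `|inner u (Q *m u) - 1| <= a ->
  (\int[P]_w (expR (truncated_excess lam v K u (X w)))%:E <=
   (expR (lam * (inner u (Q *m u) - v * r - 1) +
     (1 + c * K) / 2 * lam ^+ 2 * variance_bound d kappa v a))%:E)%E.
Proof.
move=> lam0 v0 c0 K0 Kc Na; set N := inner u (Q *m u) in Na *.
pose phi := (1 + c * K) / 2.
have phi0 : 0 <= phi by rewrite /phi; nonneg.
have phil0 : 0 <= phi * lam ^+ 2 by nonneg.
apply: (le_trans (expectation_white_le X2 kappa_gt0 X4 (u := u)
  (c0 := 1 - lam + phi * lam ^+ 2)
  (c1 := - (lam * v) + 2 * (phi * lam ^+ 2) * v)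
  (c2 := phi * lam ^+ 2 * v ^+ 2) (c3 := lam - 2 * (phi * lam ^+ 2))
  (c4 := phi * lam ^+ 2) _ _ _ _ _)) => //.
- apply: measurableT_comp => //.
  apply: (measurableT_comp (measurable_truncated_excess _ _ _ _)).
  exact: (measurable_funPT X).
- by nonneg.
- move=> w; cbv zeta.
  set S := inner (white X (X w)) (white X (X w)).
  set x := inner u (white X (X w)); set t := lam * excess v u (X w).
  have zK : truncated_excess lam v K u (X w) <= K by rewrite ge_min lexx orbT.
  have zt : truncated_excess lam v K u (X w) <= t by rewrite ge_min lexx.
  rewrite (le_trans (expR_quadratic_le c0 K0 Kc zK))//.
  have zt2 : truncated_excess lam v K u (X w) ^+ 2 <= t ^+ 2.
    rewrite /truncated_excess -/t minEle; case: (leP t K) => // /ltW Kt.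
    by rewrite lerXn2r ?nnegrE// (le_trans K0).
  apply: (@le_trans _ _ (1 + t + phi * t ^+ 2)).
    by rewrite lerD ?lerD2l// ler_wpM2l.
  have S0 : 0 <= S by exact: inner_ge0.
  have : phi * lam ^+ 2 * (2 * v * (S * x ^+ 2)) >= 0.
    by nonneg.
  by rewrite /t /excess -/S -/x; lra.
- rewrite lee_fin -/N -/r.
  have := ler_wpM2l phil0 (variance_le v0 Na).
  move=> H; apply: (le_trans _ (expR_ge1Dx _)); rewrite -/phi.
  by move: H; set V := variance_bound _ _ _ _; lra.
Qed.

(** Discarding the points whose squared norm [S] exceeds [M] changes the mean by
the expectation of the squared inner product [x ^ 2] over these points, which is
at most that of [x ^ 2 * S / M], hence at most [kappa * d * b / M]. *)
Lemma mgf_defect (lam v M b c a : R) u : 0 <= lam -> 0 <= v -> 0 < M -> 0 < b ->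
  0 < c -> lam * (1 + v * M) <= 3 - c^-1 -> (0 < d)%N ->
  `|inner u (Q *m u) - 1| <= a -> inner u (Q *m u) <= b ->
  (\int[P]_w (expR (truncated_defect lam v M u (X w)))%:E <=
   (expR (- (lam * (inner u (Q *m u) - v * r - 1)) +
     lam * (kappa * d%:R * b / M) +
     (1 + c * (lam * (1 + v * M))) / 2 * lam ^+ 2 *
       (variance_bound d kappa v a + kappa * (d%:R / M) ^+ 2)))%:E)%E.
Proof.
move=> lam0 v0 M0 b0 c0 Kc d_gt0 Na Nb; set N := inner u (Q *m u) in Na Nb *.
set K := lam * (1 + v * M) in Kc *.
have K0 : 0 <= K by rewrite /K; nonneg.
pose phi := (1 + c * K) / 2.
have phi0 : 0 <= phi by rewrite /phi; nonneg.
have phil0 : 0 <= phi * lam ^+ 2 by nonneg.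
have dR0 : 0 < d%:R :> R by rewrite ltr0n.
(* The weight that balances [x ^ 2 * S <= (eta * x ^ 4 + S ^ 2 / eta) / 2]. *)
have [eta etaE eta0] : exists2 eta, eta = d%:R / b & 0 < eta.
  by exists (d%:R / b); rewrite ?divr_gt0.
have N0 : 0 <= N by exact: inner_white_proj_ge0.
apply: (le_trans (expectation_white_le X2 kappa_gt0 X4 (u := u)
  (c0 := 1 + lam + phi * lam ^+ 2)
  (c1 := lam * v + 2 * (phi * lam ^+ 2) * v)
  (c2 := phi * lam ^+ 2 * v ^+ 2 + lam / M * (eta^-1 / 2) + phi * lam ^+ 2 * (M^-1) ^+ 2)
  (c3 := - lam - 2 * (phi * lam ^+ 2))
  (c4 := phi * lam ^+ 2 + lam / M * (eta / 2)) _ _ _ _ _)) => //.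
- apply: measurableT_comp => //.
  apply: (measurableT_comp (measurable_truncated_defect _ _ _ _)).
  exact: (measurable_funPT X).
- by nonneg.
- by nonneg.
- move=> w; cbv zeta.
  set S := inner (white X (X w)) (white X (X w)).
  set x := inner u (white X (X w)); set t := - (lam * excess v u (X w)).
  have S0 : 0 <= S by exact: inner_ge0.
  have cross : 0 <= phi * lam ^+ 2 * (2 * v * (S * x ^+ 2)).
    by nonneg.
  have amgm : x ^+ 2 * S <= eta / 2 * x ^+ 4 + eta^-1 / 2 * S ^+ 2.
    have e1 : eta * eta^-1 = 1 by rewrite mulfV// gt_eqF.
    have : 0 <= eta^-1 / 2 * (eta * x ^+ 2 - S) ^+ 2.
      by nonneg.
    rewrite (_ : eta^-1 / 2 * (eta * x ^+ 2 - S) ^+ 2 = eta / 2 * x ^+ 4 * (eta * eta^-1) -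
      (eta * eta^-1) * (x ^+ 2 * S) + eta^-1 / 2 * S ^+ 2); last first.
      by field; rewrite gt_eqF.
    by rewrite e1; lra.
  have lM0 : 0 <= lam / M by nonneg.
  have amgmM := ler_wpM2l lM0 amgm.
  have M20 : 0 <= phi * lam ^+ 2 * (M^-1) ^+ 2 * S ^+ 2.
    by nonneg.
  have t2 : phi * t ^+ 2 <= phi * lam ^+ 2 *
      (1 + v ^+ 2 * S ^+ 2 + x ^+ 4 + 2 * v * S - 2 * x ^+ 2).
    by rewrite /t /excess -/S -/x; lra.
  have tE : t = lam * (1 + v * S - x ^+ 2) by rewrite /t /excess -/S -/x; ring.
  rewrite /truncated_defect -/S -/t; case: ifPn => [SM|].
    have tK : t <= K.
      rewrite tE ler_wpM2l//.
      have := ler_wpM2l v0 SM; have := sqr_ge0 x; lra.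
    rewrite (le_trans (expR_quadratic_le c0 K0 Kc tK))// -/phi.
    have x2S0 : 0 <= lam / M * (x ^+ 2 * S) by nonneg.
    by move: t2 tE; set t' := t => t2 tE; rewrite {1}tE; lra.
  rewrite -ltNge => MS.
  have lamK : lam <= K.
    by rewrite /K -[leLHS]mulr1 ler_wpM2l// lerDl; nonneg.
  rewrite (le_trans (expR_quadratic_le c0 K0 Kc lamK))// -/phi.
  have SM1 : 1 <= M^-1 * S.
    by rewrite mulrC ler_pdivlMr// mul1r ltW.
  have SM2 : phi * lam ^+ 2 <= phi * lam ^+ 2 * (M^-1 * S) ^+ 2.
    by rewrite ler_peMr// exprn_ege1.
  have x2S : lam * x ^+ 2 <= lam * x ^+ 2 * (M^-1 * S).
    by rewrite ler_peMr//; nonneg.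
  have t20 : 0 <= phi * t ^+ 2 by nonneg.
  have vS : 0 <= lam * v * S by nonneg.
  by lra.
- rewrite lee_fin -/N -/r.
  have H := ler_wpM2l phil0 (variance_le v0 Na).
  have kd : eta / 2 * (kappa * N ^+ 2) + eta^-1 / 2 * (kappa * d%:R ^+ 2)
      <= kappa * d%:R * b.
    have NN : N ^+ 2 <= b ^+ 2 by rewrite lerXn2r// nnegrE ltW.
    have e1 : eta * b = d%:R by rewrite etaE divfK// gt_eqF.
    have e2 : eta^-1 * d%:R = b by rewrite etaE invf_div divfK// gt_eqF.
    have ek : 0 <= eta / 2 * kappa by nonneg.
    have H1 := ler_wpM2l ek NN.
    have E1 : eta / 2 * kappa * b ^+ 2 = kappa * d%:R * b / 2.
      by rewrite -e1; ring.
    have E2 : eta^-1 / 2 * (kappa * d%:R ^+ 2) = kappa * d%:R * b / 2.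
      by rewrite -[in RHS]e2; ring.
    by rewrite E2; lra.
  have lM0 : 0 <= lam / M by nonneg.
  have kdM := ler_wpM2l lM0 kd.
  apply: (le_trans _ (expR_ge1Dx _)); rewrite -/phi exprMn.
  by move: H kdM; set V := variance_bound _ _ _ _; lra.
Qed.

End exponential_moments.

(** * Bounds over the whole sphere *)

(** What a union bound over the grid adds to the deviation of a mean of [n]
terms whose exponential moment is taken at [lam]. *)
Definition deviation_cost {R : realType} (d n : nat) (rho lam eps : R) : R :=
  (entropy d rho + ln eps^-1) / (n%:R * lam).

Section uniform_bounds.
Context {R : realType} {d n : nat} {d0 d1 : measure_display}.
Context {T0 : measurableType d0} {T : measurableType d1}.
Context {P0 : probability T0 R} {P : probability T R}.
Variables (X : {RV P0 >-> d.-tuple R}) (Xs : 'I_n -> {RV P >-> d.-tuple R}).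
Variable kappa : R.
Hypotheses (X2 : square_integrable X) (kappa_gt1 : 1 < kappa).
Hypothesis X4 : (ereal_sup [set fourth_moment X theta
  | theta in [set theta : 'cV[R]_d | (energy X theta <= 1)%E]] <= kappa%:E)%E.
Hypothesis copies : independent_copies X Xs.
Hypotheses (d_gt0 : (0 < d)%N) (n_gt0 : (0 < n)%N).

Let Q := white_proj (gram X).
Let r := \tr Q.
Let psdG := psd_gram X2.

(** The unit vectors of the image of the covariance, in whitened coordinates. *)
Definition white_sphere : set 'cV[R]_d :=
  [set u | inner u u = 1 /\ Q *m u = u].

Definition white_empirical (u : 'cV[R]_d) (w : T) : R :=
  n%:R^-1 * \sum_i inner u (white X (Xs i w)) ^+ 2.

Variables (h tau rho lam c eps : R).
Hypotheses (h_gt0 : 0 < h) (tau_ge0 : 0 <= tau) (rho_gt0 : 0 < rho).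
Hypotheses (lam_gt0 : 0 < lam) (c_gt0 : 0 < c) (eps_gt0 : 0 < eps).
Hypothesis h_tau : d%:R * (3 / 2 * h) ^+ 2 <= tau ^+ 2.
Hypothesis h_rho : d%:R * (1 + tau) ^+ 2 <= (rho * d%:R * h) ^+ 2.

Let v := h ^+ 2 / 4.
Let a := 2 * tau + tau ^+ 2.

Let near (u : 'cV[R]_d) : Prop :=
  exists2 xi, white_sphere xi & inner (u - xi) (u - xi) <= tau ^+ 2.

Let near_energy u : near u ->
  `|inner u (Q *m u) - 1| <= a /\ inner u u <= (1 + tau) ^+ 2.
Proof.
move=> [xi [xi1 Qxi] uxi].
have [/andP[lo up] ub] := white_proj_perturb psdG tau_ge0 xi1 Qxi uxi.
split=> //; rewrite ler_norml /a; apply/andP; split=> //.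
by have := sqr_ge0 tau; lra.
Qed.

Let v_ge0 : 0 <= v. Proof. by rewrite /v; nonneg. Qed.

Let nR_gt0 : 0 < n%:R :> R. Proof. by rewrite ltr0n. Qed.

(** As the norms are at most [M], no excess is truncated, and at the grid point of
[moment_rounding] the term in [v] of the excess cancels the inflation. *)
Lemma uniform_upper (M : R) : 0 <= M ->
  lam * (M * (1 + tau) ^+ 2) <= 3 - c^-1 ->
  exists A : set T, [/\ measurable A, (P (~` A) <= eps%:E)%E &
    forall w, A w ->
      (forall i, inner (white X (Xs i w)) (white X (Xs i w)) <= M) ->
      forall xi, white_sphere xi ->
      white_empirical xi w <= 1 + deviation_cost d n rho lam eps
        + (1 + c * (lam * (M * (1 + tau) ^+ 2))) / 2 * lam
          * variance_bound d kappa v a].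
Proof.
move=> M0; set K := lam * _ => Kc.
have K0 : 0 <= K by rewrite /K; nonneg.
set phi := (1 + c * K) / 2; set V := variance_bound _ _ _ _.
have [A [mA PA AE]] := @grid_deviation _ _ _ _ _ _ _ _ _ X Xs copies
  h rho ((1 + tau) ^+ 2) eps near (truncated_excess X lam v K)
  (fun u => lam * (inner u (Q *m u) - v * r - 1) + phi * lam ^+ 2 * V)
  h_gt0 rho_gt0 eps_gt0 h_rho (fun u nu => (near_energy nu).2)
  (fun u _ => measurable_truncated_excess X2 lam v K u)
  (fun u nu => mgf_excess X2 kappa_gt1 X4 (ltW lam_gt0) v_ge0 c_gt0 K0 Kc
     (near_energy nu).1).
exists A; split=> // w Aw SM xi xiS; have [xi1 Qxi] := xiS.
have [k [kd kq]] := moment_rounding n%:R (fun=> -1)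
  (fun i => white X (Xs i w)) Q xi h_gt0.
set u := \col_j _ in kd kq.
have nu : near u by exists xi => //; exact: le_trans h_tau.
have /= := AE w Aw k nu; rewrite -/u.
have zE i : truncated_excess X lam v K u (Xs i w) = lam * excess X v u (Xs i w).
  apply/min_idPl; rewrite /K ler_pM2l// /excess.
  have := cauchy_schwarz u (white X (Xs i w)).
  have [_ ub] := near_energy nu.
  have := SM i; have := inner_ge0 (white X (Xs i w)); have := inner_ge0 u.
  set uu := inner u u in ub *; set S := inner _ (white X (Xs i w)).
  set x2 := inner u _ ^+ 2 => uu0 S0 S_M x2S.
  have : x2 <= M * (1 + tau) ^+ 2 by rewrite mulrC (le_trans x2S)// ler_pM.
  have : 0 <= v * S by nonneg.
  by lra.
under eq_bigr do rewrite zE; rewrite -mulr_sumr.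
have -> : \sum_i excess X v u (Xs i w) = \sum_i inner u (white X (Xs i w)) ^+ 2
    - v * \sum_i inner (white X (Xs i w)) (white X (Xs i w)) - n%:R.
  by rewrite /excess !sumrB sumr_const card_ord mulr_sumr.
move: kq; rewrite Qxi xi1 -/v -/r.
have sumN (F : 'I_n -> R) : \sum_i -1 * F i = - \sum_i F i.
  by rewrite -mulr_sumr mulN1r.
rewrite !sumN.
rewrite /white_empirical.
set SS := \sum_i inner (white _ _) _; set Su := \sum_i inner u _ ^+ 2.
set Sx := \sum_i inner xi _ ^+ 2; set N := inner u _ => kq Ez.
have key : Sx < n%:R * (1 + phi * lam * V) + (entropy d rho + ln eps^-1) / lam.
  have : lam * (Sx - n%:R * (1 + phi * lam * V)) < entropy d rho + ln eps^-1.
    have := ler_wpM2l (ltW lam_gt0) kq; lra.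
  by move=> H; rewrite -ltrBlDl ltr_pdivlMr// mulrC.
rewrite /deviation_cost invfM mulrA mulrC ler_pdivrMr//.
rewrite (le_trans (ltW key))// le_eqVlt; apply/orP; left; apply/eqP.
by field; rewrite !gt_eqF.
Qed.

(** The rounding is applied to the points kept by the truncation only; since the
others are dropped from a sum of squares, the bound holds for the full sample. *)
Lemma uniform_lower (M : R) : 0 < M ->
  lam * (1 + v * M) <= 3 - c^-1 ->
  exists A : set T, [/\ measurable A, (P (~` A) <= eps%:E)%E &
    forall w, A w -> forall xi, white_sphere xi ->
      1 - (deviation_cost d n rho lam eps + kappa * d%:R * (1 + tau) ^+ 2 / M
        + (1 + c * (lam * (1 + v * M))) / 2 * lam
          * (variance_bound d kappa v a + kappa * (d%:R / M) ^+ 2))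
      <= white_empirical xi w].
Proof.
move=> M0; set K := lam * (1 + v * M) => Kc.
set phi := (1 + c * K) / 2; set V := variance_bound _ _ _ _ + _.
set B := kappa * d%:R * (1 + tau) ^+ 2 / M.
have b0 : 0 < (1 + tau) ^+ 2 by rewrite exprn_gt0// ltr_wpDr.
have [A [mA PA AE]] := @grid_deviation _ _ _ _ _ _ _ _ _ X Xs copies
  h rho ((1 + tau) ^+ 2) eps near (truncated_defect X lam v M)
  (fun u => - (lam * (inner u (Q *m u) - v * r - 1)) + lam * B
     + phi * lam ^+ 2 * V)
  h_gt0 rho_gt0 eps_gt0 h_rho (fun u nu => (near_energy nu).2)
  (fun u _ => measurable_truncated_defect X2 lam v M u)
  (fun u nu => mgf_defect X2 kappa_gt1 X4 (ltW lam_gt0) v_ge0 M0 b0 c_gt0 Kc d_gt0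
     (near_energy nu).1
     (le_trans (inner_white_proj_le psdG u) (near_energy nu).2)).
exists A; split=> // w Aw xi xiS; have [xi1 Qxi] := xiS.
pose g i : R := if inner (white X (Xs i w)) (white X (Xs i w)) <= M then 1 else 0.
have g01 i : 0 <= g i <= 1 by rewrite /g; case: (_ <= M); rewrite ?lexx ?ler01.
have [k [kd kq]] := moment_rounding (- n%:R) g
  (fun i => white X (Xs i w)) Q xi h_gt0.
set u := \col_j _ in kd kq.
have nu : near u by exists xi => //; exact: le_trans h_tau.
have /= := AE w Aw k nu; rewrite -/u.
have zE i : truncated_defect X lam v M u (Xs i w) =
    lam * (1 - g i * inner u (white X (Xs i w)) ^+ 2
             + v * (g i * inner (white X (Xs i w)) (white X (Xs i w)))).
  by rewrite /truncated_defect /excess /g; case: (_ <= M) => /=; ring.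
under eq_bigr do rewrite zE; rewrite -mulr_sumr.
rewrite big_split /= sumrB sumr_const card_ord -mulr_sumr.
move: kq; rewrite Qxi xi1 -/v -/r.
rewrite /white_empirical.
set SS := \sum_i (g i * inner (white _ _) _).
set Su := \sum_i (g i * inner u _ ^+ 2).
set Sg := \sum_i (g i * inner xi _ ^+ 2).
set N := inner u _; rewrite -[1 *+ n]/(n%:R) => kq Ez.
have Sg_le : Sg <= \sum_i inner xi (white X (Xs i w)) ^+ 2.
  apply: ler_sum => i _; have /andP[_ g1] := g01 i.
  by rewrite -[leRHS]mul1r ler_wpM2r// sqr_ge0.
have key : n%:R * (1 - (B + phi * lam * V)) - (entropy d rho + ln eps^-1) / lam < Sg.
  have : lam * (n%:R * (1 - (B + phi * lam * V)) - Sg) < entropy d rho + ln eps^-1.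
    have := ler_wpM2l (ltW lam_gt0) kq; lra.
  by rewrite mulrC -ltr_pdivlMr// => H; lra.
rewrite [leRHS]mulrC ler_pdivlMr// (le_trans _ Sg_le)// (le_trans _ (ltW key))//.
rewrite /deviation_cost le_eqVlt; apply/orP; left; apply/eqP.
by field; rewrite !gt_eqF.
Qed.

End uniform_bounds.

(** * Choice of the parameters *)

Section numeric.
Context {R : realType}.
Implicit Types (m e E r s t : R).

(** The error term [2 / 5 * r * m] is absorbed by [m ^ 2] and [r ^ 2 / 3]: after
multiplication by [1 - m], completing the square leaves the inequality
[12 / 100 * (1 - m) ^ 2 <= 1 - 2 * m], which is where the bound on [m] matters. *)
Lemma lower_numeric (m1 : R) e E r (m := m1 + 681 / 100 * e) : 0 < r -> 0 < m1 ->
  0 < e -> m < 4817 / 10000 -> E <= m1 + 2 / 5 * r * m1 + 4 * e ->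
  E <= (m / (1 - 2 * m) + r ^+ 2 / 3) / (1 + m / (1 - 2 * m)).
Proof.
move=> r0 m10 e0 mlt Ele; have m0 : 0 < m by rewrite /m; lra.
have Em : E <= m + 2 / 5 * r * m.
  have : 0 <= r * e by rewrite mulr_ge0// ltW.
  by rewrite /m; lra.
move: m mlt m0 Em {Ele m10 e0} => m mlt m0 Em.
rewrite (_ : (_ + _) / _ = (m + r ^+ 2 / 3 * (1 - 2 * m)) / (1 - m)); last first.
  by field; rewrite !gt_eqF//; lra.
rewrite ler_pdivlMr; last by lra.
apply: (le_trans (ler_wpM2r _ Em)); first by lra.
have sq := sqr_ge0 (m - 1 / 5 * r * (1 - m)).
have disc : 12 / 100 * (1 - m) ^+ 2 <= 1 - 2 * m by nra.
have := ler_wpM2l (sqr_ge0 r) disc.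
lra.
Qed.

(** The error term [79 / 100 * s * m] is absorbed by [s ^ 2 / 3] and by the margin
[2 * m ^ 2] that [t] has over [m]. *)
Lemma upper_numeric (m1 : R) e E s t (m := m1 + 681 / 100 * e) : 0 <= s -> 0 < m1 ->
  0 < e -> m + 2 * m ^+ 2 <= t -> t < 1 -> s ^+ 2 / 3 < 1 ->
  E <= m1 + 79 / 100 * s * m1 + 41 / 10 * e ->
  E <= (t + s ^+ 2 / 3) / ((1 - t) * (1 - s ^+ 2 / 3)).
Proof.
move=> s0 m10 e0 mt t1 s1 Ele; have m0 : 0 < m by rewrite /m; lra.
have t0 : 0 < t by have := sqr_ge0 m; lra.
have Em : E <= m + 79 / 100 * s * m.
  have : 0 <= s * e by rewrite mulr_ge0// ltW.
  by rewrite /m; lra.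
apply: (@le_trans _ _ (t + s ^+ 2 / 3)).
  have := sqr_ge0 (s - 6 / 5 * m); have := sqr_ge0 s; have := sqr_ge0 m; lra.
rewrite ler_pdivlMr; last by rewrite mulr_gt0 ?subr_gt0.
by rewrite ler_piMr ?addr_ge0 ?divr_ge0 ?sqr_ge0 ?(ltW t0)//;
  have := sqr_ge0 s; nra.
Qed.

End numeric.

Section threshold.
Context {R : realType}.
Variables (d n : nat) (kappa eps : R).
Hypotheses (kappa_gt1 : 1 < kappa) (C_ge0 : 0 <= complexity d eps).

Local Notation C := (complexity d eps).
Local Notation mu := (mu_ d n kappa eps).
Local Notation delta := (delta_hat d n kappa eps).

(** The two terms of [mu_]: the deviation of a single direction, and the price
of uniformity over the directions. *)
Definition deviation_term : R := Num.sqrt (2 * (kappa - 1) / n%:R * C).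
Definition dim_term : R := Num.sqrt (2 * kappa * d%:R / n%:R).

Let k1_gt0 : 0 < kappa - 1. Proof. by rewrite subr_gt0. Qed.
Let k_gt0 : 0 < kappa. Proof. exact: lt_trans kappa_gt1. Qed.

Lemma mu_sum : mu = deviation_term + 681 / 100 * dim_term.
Proof. by []. Qed.

Lemma deviation_term_ge0 : 0 <= deviation_term. Proof. exact: sqrtr_ge0. Qed.

Lemma dim_term_ge0 : 0 <= dim_term. Proof. exact: sqrtr_ge0. Qed.

Lemma deviation_term_sqr : deviation_term ^+ 2 = 2 * (kappa - 1) / n%:R * C.
Proof. by rewrite sqr_sqrtr//; nonneg. Qed.

Lemma dim_term_sqr : dim_term ^+ 2 = 2 * kappa * d%:R / n%:R.
Proof. by rewrite sqr_sqrtr//; nonneg. Qed.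

Lemma mu_ge0 : 0 <= mu.
Proof.
have := deviation_term_ge0; have := dim_term_ge0; rewrite mu_sum.
by move: deviation_term dim_term => x y; lra.
Qed.

Hypothesis n_large : sample_threshold d kappa eps < n%:R.

Lemma sample_gt0 : 0 < n%:R :> R.
Proof. exact: le_lt_trans (sqr_ge0 _) n_large. Qed.

Let nR_gt0 := sample_gt0.

(** The two constants of the sample threshold that keep [mu_] below 1/2:
[707 / 50] is just below [20 / sqrt 2]. *)
Lemma dim_term_mu : 707 / 50 * dim_term + 5 / 2 * deviation_term < 1.
Proof.
pose sn := Num.sqrt (n%:R : R); have sn_gt0 : 0 < sn by rewrite sqrtr_gt0.
have sn2 : sn ^+ 2 = n%:R by rewrite sqr_sqrtr// ltW.
set Z := 20 * Num.sqrt (kappa * d%:R) + (5 / 2 + 1 / (2 * (kappa - 1)))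
     * Num.sqrt (2 * (kappa - 1) * C).
have kd0 : 0 <= kappa * d%:R by nonneg.
have kC0 : 0 <= 2 * (kappa - 1) * C by nonneg.
have inv0 : 0 <= 1 / (2 * (kappa - 1)) * Num.sqrt (2 * (kappa - 1) * C).
  by rewrite mulr_ge0 ?sqrtr_ge0// divr_ge0// mulr_ge0// ltW.
have Z0 : 0 <= Z.
  have := sqrtr_ge0 (kappa * d%:R); have := sqrtr_ge0 (2 * (kappa - 1) * C).
  by rewrite /Z; lra.
have Zsn : Z < sn.
  by rewrite -(@ltr_pXn2r _ 2)// ?nnegrE ?(ltW sn_gt0)// sn2.
have e_sn : 707 / 50 * dim_term * sn <= 20 * Num.sqrt (kappa * d%:R).
  rewrite -(@ler_pXn2r _ 2)// ?nnegrE; last 2 first.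
  - by apply: mulr_ge0; [have := dim_term_ge0; lra|exact: ltW].
  - by rewrite mulr_ge0 ?sqrtr_ge0.
  rewrite !exprMn dim_term_sqr sn2 sqr_sqrtr// -!mulrA mulVf ?gt_eqF// mulr1.
  by move: kd0; set kd := kappa * _ => kd0; lra.
have mu1_sn : deviation_term * sn = Num.sqrt (2 * (kappa - 1) * C).
  apply/eqP; rewrite -(@eqrXn2 _ 2) ?sqrtr_ge0//; last first.
    by rewrite mulr_ge0 ?sqrtr_ge0.
  rewrite !exprMn deviation_term_sqr sn2 sqr_sqrtr//; apply/eqP.
  by field; rewrite !gt_eqF.
rewrite -(ltr_pM2r sn_gt0) mul1r (le_lt_trans _ Zsn)// /Z [leRHS]addrC.
rewrite mulrDl -[_ * sn in X in _ + X <= _]mulrA mu1_sn; lra.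
Qed.

Lemma mu_lt : mu < 4817 / 10000.
Proof.
have := deviation_term_ge0; have := dim_term_ge0; have := dim_term_mu.
by rewrite mu_sum; move: deviation_term dim_term => x y; lra.
Qed.

Lemma delta_hat_bounds : mu + 2 * mu ^+ 2 <= delta <= 28 * mu.
Proof.
have m0 := mu_ge0; have mlt := mu_lt; rewrite /delta_hat; move: (mu) m0 mlt => m m0 mlt.
have den : 0 < 1 - 2 * m by lra.
by rewrite ler_pdivlMr// ler_pdivrMr//; apply/andP; split; nra.
Qed.

Lemma delta_hat_ge0 : 0 <= delta.
Proof.
by have /andP[] := delta_hat_bounds; have := mu_ge0; have := sqr_ge0 mu; lra.
Qed.

Lemma lower_bound_le :
  lower_bound d n kappa eps <= (1 + (3 * (kappa - 1) ^+ 2)^-1) * delta.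
Proof.
have m0 := mu_ge0; have mlt := mu_lt; have d0 := delta_hat_ge0.
have /andP[md _] := delta_hat_bounds.
have gE : gamma_minus d n kappa eps = (3 * (kappa - 1) ^+ 2)^-1 * deviation_term ^+ 2.
  by rewrite deviation_term_sqr /gamma_minus; field; rewrite !gt_eqF.
have inv0 : 0 <= (3 * (kappa - 1) ^+ 2)^-1.
  by rewrite invr_ge0 mulr_ge0 ?sqr_ge0.
rewrite /lower_bound gE; move: (_^-1) inv0 => c c0.
have dev : deviation_term ^+ 2 <= delta.
  have := deviation_term_ge0; have := dim_term_ge0; rewrite mu_sum in mlt md.
  by move: deviation_term dim_term delta mlt md => x y t; nra.
have g0 : 0 <= c * deviation_term ^+ 2 by rewrite mulr_ge0 ?sqr_ge0.
have cdev := ler_wpM2l c0 dev.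
rewrite ler_pdivrMr; last by lra.
have : 0 <= c * delta * delta + delta * delta by nonneg.
by lra.
Qed.

Lemma delta_hat_order : delta <= 629 * Num.sqrt (kappa * (d%:R + ln eps^-1) / n%:R).
Proof.
have CE : C = ln eps^-1 + 73 / 100 * d%:R by [].
have dR0 : 0 <= d%:R :> R by [].
have s2_ge0 : 0 <= d%:R + ln eps^-1 by have := C_ge0; rewrite CE; lra.
set s := Num.sqrt _; have s0 : 0 <= s by exact: sqrtr_ge0.
have nV : 0 < kappa / n%:R by rewrite divr_gt0.
have s2 : s ^+ 2 = kappa / n%:R * (d%:R + ln eps^-1).
  by rewrite sqr_sqrtr; [ring|nonneg].
have dev : deviation_term <= 2 * s.
  rewrite -(@ler_pXn2r _ 2)// ?nnegrE ?deviation_term_ge0 ?mulr_ge0//.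
  rewrite exprMn s2 deviation_term_sqr.
  rewrite (_ : _ * C = 2 * (kappa / n%:R * C) - 2 * (C / n%:R)); last by ring.
  have : 0 <= C / n%:R by rewrite divr_ge0.
  have : kappa / n%:R * C <= kappa / n%:R * (d%:R + ln eps^-1).
    by rewrite ler_pM2l// CE; lra.
  by have := mulr_ge0 (ltW nV) s2_ge0; lra.
have dim : dim_term <= 3 * s.
  rewrite -(@ler_pXn2r _ 2)// ?nnegrE ?dim_term_ge0 ?mulr_ge0//.
  rewrite exprMn s2 dim_term_sqr.
  rewrite (_ : _ / _ = kappa / n%:R * (2 * d%:R)); last by ring.
  rewrite [leRHS]mulrCA ler_pM2l//; have := C_ge0; rewrite CE; lra.
have /andP[_ dm] := delta_hat_bounds; rewrite mu_sum in dm.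
by move: deviation_term dim_term dev dim dm => x y; lra.
Qed.

End threshold.

Section tuning.
Context {R : realType}.
Variables (d n : nat) (kappa eps : R).
Hypotheses (d_gt0 : (0 < d)%N) (kappa_gt1 : 1 < kappa).
Hypothesis C_ge : 73 / 100 * d%:R < complexity d eps.
Hypothesis n_large : sample_threshold d kappa eps < n%:R.

Local Notation C := (complexity d eps).
Local Notation dim_term := (dim_term d n kappa).
Local Notation mu := (mu_ d n kappa eps).

(** The argument of the exponential moments, which balances the variance term
[rate * (kappa - 1) / 2] and the confidence term [C / (n * rate)]. *)
Definition rate : R := Num.sqrt (2 * C / (n%:R * (kappa - 1))).
(** The square root of [(kappa - 1) / kappa * (d / C)]. By [dim_termE], a
perturbation of energies proportional to [aspect] costs a multiple of
[dim_term]. *)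
Definition aspect : R := Num.sqrt ((kappa - 1) * d%:R / (kappa * C)).

Let dR_gt0 : 0 < d%:R :> R. Proof. by rewrite ltr0n. Qed.
Let k1_gt0 : 0 < kappa - 1. Proof. by rewrite subr_gt0. Qed.
Let k_gt0 : 0 < kappa. Proof. exact: lt_trans kappa_gt1. Qed.
Let C_gt0 : 0 < C. Proof. by apply: le_lt_trans C_ge; nonneg. Qed.
Let nR_gt0 : 0 < n%:R :> R.
Proof. exact: le_lt_trans (sqr_ge0 _) n_large. Qed.

Lemma rate_gt0 : 0 < rate.
Proof. by rewrite sqrtr_gt0 divr_gt0 ?mulr_gt0. Qed.

Lemma dim_term_gt0 : 0 < dim_term.
Proof. by rewrite sqrtr_gt0 divr_gt0 ?mulr_gt0. Qed.

Lemma aspect_gt0 : 0 < aspect.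
Proof. by rewrite sqrtr_gt0 divr_gt0 ?mulr_gt0. Qed.

Let rate_sqr : rate ^+ 2 = 2 * C / (n%:R * (kappa - 1)).
Proof. by rewrite sqr_sqrtr// divr_ge0 ?mulr_ge0// ltW. Qed.

Let aspect_sqr : aspect ^+ 2 = (kappa - 1) * d%:R / (kappa * C).
Proof. by rewrite sqr_sqrtr// divr_ge0 ?mulr_ge0// ltW. Qed.

Lemma aspect_le : aspect <= 6 / 5.
Proof.
rewrite -(@ler_pXn2r _ 2)// ?nnegrE ?sqrtr_ge0 ?divr_ge0// aspect_sqr.
rewrite ler_pdivrMr ?mulr_gt0//; have := C_ge; set c := C => Cge.
have : kappa * (73 / 100 * d%:R) <= kappa * c by rewrite ler_pM2l// ltW.
have : 0 < kappa * d%:R by rewrite mulr_gt0.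
by have := dR_gt0; lra.
Qed.

Lemma dim_termE : rate * kappa * aspect = dim_term.
Proof.
apply/eqP; rewrite -(@eqrXn2 _ 2)//; last 2 first.
- by rewrite !mulr_ge0 ?sqrtr_ge0// ltW.
- exact: sqrtr_ge0.
rewrite !exprMn rate_sqr aspect_sqr (dim_term_sqr _ _ kappa_gt1); apply/eqP.
by field; rewrite !gt_eqF.
Qed.

Lemma muE : mu = rate * (kappa - 1) + 681 / 100 * dim_term.
Proof.
congr (_ + _); apply/eqP; rewrite -(@eqrXn2 _ 2) ?sqrtr_ge0//; last first.
  by rewrite mulr_ge0 ?sqrtr_ge0// ltW.
rewrite exprMn rate_sqr sqr_sqrtr; last by nonneg.
by apply/eqP; field; rewrite !gt_eqF.
Qed.

Lemma complexityE : C = n%:R * rate * (rate * (kappa - 1) / 2).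
Proof.
rewrite (_ : n%:R * rate * _ = n%:R * rate ^+ 2 * (kappa - 1) / 2); last by ring.
by rewrite rate_sqr; field; rewrite !gt_eqF.
Qed.

Lemma dimE : d%:R = n%:R * rate * (dim_term * aspect / 2).
Proof.
rewrite -dim_termE.
rewrite (_ : n%:R * rate * _ = n%:R * rate ^+ 2 * kappa * aspect ^+ 2 / 2); last by ring.
by rewrite rate_sqr aspect_sqr; field; rewrite !gt_eqF.
Qed.

Lemma gamma_plus_ofE r4 : gamma_plus_of d n kappa eps r4 =
  rate ^+ 2 * r4 * (1 + delta_hat d n kappa eps) ^+ 2 / 3.
Proof.
rewrite rate_sqr /gamma_plus_of; set D := delta_hat _ _ _ _.
by field; rewrite !gt_eqF.
Qed.

Lemma gamma_minusE : gamma_minus d n kappa eps = rate ^+ 2 / 3.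
Proof. by rewrite rate_sqr /gamma_minus; field; rewrite !gt_eqF. Qed.

Lemma dim_term_le : dim_term <= 1 / 10.
Proof.
have := dim_term_mu kappa_gt1 (ltW C_gt0) n_large.
by have := deviation_term_ge0 d n kappa eps; lra.
Qed.

Lemma delta_hat_ge : mu + 2 * mu ^+ 2 <= delta_hat d n kappa eps.
Proof. by have /andP[] := delta_hat_bounds kappa_gt1 (ltW C_gt0) n_large. Qed.

Lemma delta_hat_gt0 : 0 < delta_hat d n kappa eps.
Proof.
have := delta_hat_ge; have : 0 < rate * (kappa - 1) by rewrite mulr_gt0 ?rate_gt0.
by have := dim_term_gt0; have := sqr_ge0 mu; rewrite {2}muE; lra.
Qed.

(** With this mesh the rounding moves a vector by at most [grid_radius], and
[grid_ratio] is the parameter of [entropy] for the ball of radius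
[1 + grid_radius]. *)
Definition grid_mesh : R := aspect / (15 * Num.sqrt d%:R).
Definition grid_radius : R := aspect / 10.
Definition grid_ratio : R := 15 * (1 + grid_radius) / aspect.

Let sd_gt0 : 0 < Num.sqrt (d%:R : R). Proof. by rewrite sqrtr_gt0. Qed.
Let sd2 : Num.sqrt (d%:R : R) ^+ 2 = d%:R. Proof. by rewrite sqr_sqrtr// ltW. Qed.

Lemma grid_mesh_gt0 : 0 < grid_mesh.
Proof. by rewrite divr_gt0 ?mulr_gt0 ?aspect_gt0. Qed.

Lemma grid_radius_ge0 : 0 <= grid_radius.
Proof. by rewrite divr_ge0 ?(ltW aspect_gt0). Qed.

Lemma grid_ratio_gt0 : 0 < grid_ratio.
Proof.
by rewrite !(divr_gt0, mulr_gt0) ?aspect_gt0// ltr_wpDr ?grid_radius_ge0.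
Qed.

Let grid_mesh_sqr : grid_mesh ^+ 2 = aspect ^+ 2 / (225 * d%:R).
Proof.
rewrite /grid_mesh exprMn exprVn exprMn sd2; congr (_ / (_ * _)).
by ring.
Qed.

Lemma grid_mesh_radius : d%:R * (3 / 2 * grid_mesh) ^+ 2 <= grid_radius ^+ 2.
Proof.
rewrite exprMn grid_mesh_sqr /grid_radius le_eqVlt; apply/orP; left; apply/eqP.
by field; rewrite gt_eqF.
Qed.

Lemma grid_mesh_ratio :
  d%:R * (1 + grid_radius) ^+ 2 <= (grid_ratio * d%:R * grid_mesh) ^+ 2.
Proof.
rewrite exprMn grid_mesh_sqr /grid_ratio le_eqVlt; apply/orP; left; apply/eqP.
by field; rewrite !gt_eqF ?aspect_gt0.
Qed.

Lemma grid_mesh_dim : grid_mesh ^+ 2 / 4 * d%:R = aspect ^+ 2 / 900.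
Proof. by rewrite grid_mesh_sqr; field; rewrite gt_eqF. Qed.

(** The tangent at 16, with [ln 16 <= 4]. *)
Lemma ln_le_affine (x : R) : 0 < x -> ln x <= 3 + x / 16.
Proof.
move=> x0; have x16 : 0 < x / 16 by rewrite divr_gt0.
have -> : x = x / 16 * 2 ^+ 4 by field.
rewrite lnM ?posrE ?exprn_gt0// lnXn//.
have l2 : ln 2 <= 1 :> R by have := @le_ln1Dx R 1; lra.
have : ln (x / 16) <= x / 16 - 1.
  have := @le_ln1Dx R (x / 16 - 1); rewrite addrCA subrr addr0; apply; lra.
by rewrite -[ln 2 *+ 4]mulr_natr; lra.
Qed.

Lemma deviation_cost_le : deviation_cost d n grid_ratio rate eps <=
  rate * (kappa - 1) / 2 + 31 / 10 * dim_term.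
Proof.
have y0 := aspect_gt0; have e0 := dim_term_gt0; have l0 := rate_gt0.
rewrite /deviation_cost /entropy.
have -> : ln eps^-1 = C - 73 / 100 * d%:R by rewrite /complexity; ring.
rewrite ler_pdivrMr ?mulr_gt0//.
have nl0 : 0 < n%:R * rate by rewrite mulr_gt0.
set H := ln _.
have yH : aspect * H <= 3 * aspect + (5 * aspect + 30) / 16.
  have := @ln_le_affine (2 * (1 + grid_ratio)).
  rewrite mulr_gt0 ?addr_gt0 ?grid_ratio_gt0// => /(_ isT).
  rewrite -/H => /(ler_wpM2l (ltW y0)) /le_trans; apply.
  rewrite le_eqVlt; apply/orP; left; apply/eqP.
  by rewrite /grid_ratio /grid_radius; field; rewrite gt_eqF.
have yle := aspect_le.
have yH' : aspect * (27 / 100 + H) <= 62 / 10 by lra.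
rewrite (_ : _ + _ = C + d%:R * (27 / 100 + H)); last by lra.
rewrite {1}complexityE {1}dimE.
have := ler_wpM2l (ltW nl0) (ler_wpM2l (ltW e0) yH').
by lra.
Qed.

Local Notation mu1 := (rate * (kappa - 1)).
Local Notation v := (grid_mesh ^+ 2 / 4).
Local Notation a := (2 * grid_radius + grid_radius ^+ 2).
Local Notation V := (variance_bound d kappa v a).
Local Notation delta := (delta_hat d n kappa eps).

Let mu1_gt0 : 0 < mu1. Proof. by rewrite mulr_gt0 ?rate_gt0. Qed.

Let rate_aspect : rate * aspect <= dim_term.
Proof.
rewrite -dim_termE ler_pM2r ?aspect_gt0//.
by rewrite ler_peMr ?(ltW rate_gt0)// ltW.
Qed.

Let mu1_aspect : mu1 * aspect <= dim_term.
Proof.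
rewrite -dim_termE ler_pM2r ?aspect_gt0// ler_pM2l ?rate_gt0//.
by rewrite gerBl.
Qed.

Lemma grid_radius_sqr_le : 0 <= (1 + grid_radius) ^+ 2 <= 126 / 100.
Proof.
rewrite sqr_ge0 /grid_radius; have := aspect_le; have := aspect_gt0; nra.
Qed.

Lemma rate_variance_le : 0 <= rate * V <= mu1 + 1 / 2 * dim_term.
Proof.
have y0 := aspect_gt0; have yle := aspect_le; have e0 := dim_term_gt0.
have gr0 := grid_radius_ge0; have a_ge0 : 0 <= a by nonneg.
have a_le : a <= 212 / 1000 * aspect by rewrite /grid_radius; nra.
have V0 : 0 <= V.
  have v0 : 0 <= v by nonneg.
  by rewrite /variance_bound; move: (a) (v) a_ge0 v0 => a' v' a'0 v'0; nonneg.
rewrite mulr_ge0 ?(ltW rate_gt0)//=.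
have vd : v * d%:R = aspect ^+ 2 / 900 := grid_mesh_dim.
have -> : rate * V = mu1 + 2 * (mu1 * a) + rate * kappa * a ^+ 2
    + rate * kappa * (aspect ^+ 2 / 900) ^+ 2 + 2 * rate * (aspect ^+ 2 / 900).
  by rewrite /variance_bound -vd; ring.
have t1 : mu1 * a <= 212 / 1000 * dim_term.
  by have := ler_wpM2l (ltW mu1_gt0) a_le; have := mu1_aspect; lra.
have a2 : a ^+ 2 <= 54 / 1000 * aspect by nra.
have rk0 : 0 <= rate * kappa by rewrite mulr_ge0 ?(ltW rate_gt0)// ltW.
have t2 : rate * kappa * a ^+ 2 <= 54 / 1000 * dim_term.
  by have := ler_wpM2l rk0 a2; rewrite -dim_termE; lra.
have y2 : aspect ^+ 2 <= 6 / 5 * aspect by nra.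
have y4 : (aspect ^+ 2 / 900) ^+ 2 <= 1 / 1000 * aspect.
  have : aspect ^+ 2 <= 36 / 25 by nra.
  by have := sqr_ge0 aspect; set y2' := aspect ^+ 2 in y2 *; nra.
have t3 : rate * kappa * (aspect ^+ 2 / 900) ^+ 2 <= 1 / 1000 * dim_term.
  by have := ler_wpM2l rk0 y4; rewrite -dim_termE; lra.
have t4 : rate * (aspect ^+ 2 / 900) <= 2 / 900 * dim_term.
  by have := ler_wpM2l (ltW rate_gt0) y2; have := rate_aspect; lra.
lra.
Qed.

(** The squared norm above which a sample point is discarded in the lower bound:
large enough for the loss [kappa * d / norm_cutoff] to be [dim_term / 10], and
small enough not to affect the bound on the truncated defect much. *)
Definition norm_cutoff : R := 10 * kappa * d%:R / dim_term.

Lemma norm_cutoff_gt0 : 0 < norm_cutoff.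
Proof. by rewrite divr_gt0 ?dim_term_gt0 ?mulr_gt0. Qed.

Lemma rate_cutoff : rate * (1 + v * norm_cutoff) = rate + aspect / 90.
Proof.
have e0 := dim_term_gt0.
rewrite (_ : v * norm_cutoff = 10 * kappa * (v * d%:R) / dim_term); last first.
  by rewrite /norm_cutoff; ring.
rewrite grid_mesh_dim -dim_termE; field.
by rewrite !gt_eqF ?rate_gt0 ?aspect_gt0.
Qed.

(** When [gamma_minus < 1], [rate] is at most [sqrt 3] and the truncated defect at
most [7 / 4], for which [4 / 5] is an admissible slope in [expR_quadratic_le]. *)
Lemma lower_tail_cost : gamma_minus d n kappa eps < 1 ->
  rate * (1 + v * norm_cutoff) <= 3 - (4 / 5)^-1 /\
  deviation_cost d n grid_ratio rate eps
    + kappa * d%:R * (1 + grid_radius) ^+ 2 / norm_cutoff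
    + (1 + 4 / 5 * (rate * (1 + v * norm_cutoff))) / 2 * rate
      * (V + kappa * (d%:R / norm_cutoff) ^+ 2)
  <= lower_bound d n kappa eps.
Proof.
rewrite /lower_bound gamma_minusE => g1.
have y0 := aspect_gt0; have yle := aspect_le; have e0 := dim_term_gt0.
have r0 := rate_gt0; have rlt : rate < 1733 / 1000 by nra.
rewrite rate_cutoff; split.
  by rewrite (_ : (4 / 5)^-1 = 5 / 4 :> R); [lra|field].
have bias : kappa * d%:R * (1 + grid_radius) ^+ 2 / norm_cutoff
    <= 126 / 1000 * dim_term.
  rewrite (_ : _ / norm_cutoff = (1 + grid_radius) ^+ 2 * dim_term / 10); last first.
    by rewrite /norm_cutoff; field; rewrite !gt_eqF.
  have /andP[_ b2] := grid_radius_sqr_le.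
  by have := ler_wpM2r (ltW e0) b2; lra.
have tail : rate * (kappa * (d%:R / norm_cutoff) ^+ 2) <= 2 / 1000 * dim_term.
  rewrite (_ : rate * (kappa * _) = rate * dim_term ^+ 2 / 100 / kappa); last first.
    by rewrite /norm_cutoff; field; rewrite !gt_eqF.
  have ele := dim_term_le.
  rewrite ler_pdivrMr//.
  have re : rate * dim_term ^+ 2 <= 1733 / 10000 * dim_term by nra.
  have : dim_term <= dim_term * kappa by rewrite ler_peMr ?(ltW e0)// ltW.
  lra.
have /andP[rV0 rV] := rate_variance_le.
have dev := deviation_cost_le.
have var : (1 + 4 / 5 * (rate + aspect / 90)) / 2 * rate
      * (V + kappa * (d%:R / norm_cutoff) ^+ 2)
    <= mu1 / 2 + 2 / 5 * rate * mu1 + 7 / 10 * dim_term.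
  rewrite (_ : _ * (_ + _) = (1 + 4 / 5 * (rate + aspect / 90)) / 2
    * (rate * V + rate * (kappa * (d%:R / norm_cutoff) ^+ 2))); last by ring.
  set t := rate * (kappa * _) in tail *; set w := rate * V in rV0 rV *.
  apply: (@le_trans _ _ ((1 + 4 / 5 * (rate + aspect / 90)) / 2
      * (mu1 + 51 / 100 * dim_term))).
    by rewrite ler_wpM2l//; [lra|lra].
  have := mu1_aspect; set m := mu1 => my.
  have ye : aspect * dim_term <= 6 / 5 * dim_term by rewrite ler_pM2r.
  have re : rate * dim_term <= 1733 / 1000 * dim_term by rewrite ler_pM2r// ltW.
  lra.
set E := _ + _ + _; have Ele : E <= mu1 + 2 / 5 * rate * mu1 + 4 * dim_term.
  by rewrite /E; lra.
have := lower_numeric rate_gt0 mu1_gt0 dim_term_gt0 _ Ele.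
by rewrite -muE; apply; exact: (mu_lt kappa_gt1 (ltW C_gt0) n_large).
Qed.

(** Here [g < 1] keeps [rate * M * (1 + delta)] below [sqrt 3] and the truncated
excess below [11 / 5], for which [5 / 4] is an admissible slope in
[expR_quadratic_le]. *)
Lemma upper_tail_cost (M : R) : 0 <= M ->
  let g := gamma_plus_of d n kappa eps (M ^+ 2) in g < 1 -> delta < 1 ->
  rate * (M * (1 + grid_radius) ^+ 2) <= 3 - (5 / 4)^-1 /\
  deviation_cost d n grid_ratio rate eps
    + (1 + 5 / 4 * (rate * (M * (1 + grid_radius) ^+ 2))) / 2 * rate * V
  <= (delta + g) / ((1 - delta) * (1 - g)).
Proof.
move=> M0; cbv zeta; rewrite gamma_plus_ofE => g1 delta1.
have y0 := aspect_gt0; have yle := aspect_le; have e0 := dim_term_gt0.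
have r0 := rate_gt0; have delta0 := delta_hat_gt0.
have /andP[b0 b2] := grid_radius_sqr_le.
set b := (1 + grid_radius) ^+ 2 in b0 b2 *.
pose s := rate * M * (1 + delta).
have s0 : 0 <= s by rewrite /s !mulr_ge0 ?(ltW r0)// addr_ge0// ltW.
have sE : rate ^+ 2 * M ^+ 2 * (1 + delta) ^+ 2 / 3 = s ^+ 2 / 3.
  by rewrite /s; ring.
rewrite sE in g1 *.
have s_lt : s < 1733 / 1000 by nra.
have rM0 : 0 <= rate * M by rewrite mulr_ge0// ltW.
have rMs : rate * M <= s by rewrite /s ler_peMr// lerDl ltW.
set K := rate * (M * b).
have Ks : K <= 126 / 100 * s.
  rewrite /K mulrA; have := ler_wpM2l rM0 b2; lra.
have K0 : 0 <= K by rewrite /K mulrA mulr_ge0.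
split; first by rewrite (_ : (5 / 4)^-1 = 4 / 5 :> R); [lra|field].
have /andP[rV0 rV] := rate_variance_le.
have dev := deviation_cost_le.
have var : (1 + 5 / 4 * K) / 2 * rate * V <= mu1 / 2 + 79 / 100 * s * mu1 + dim_term.
  rewrite -mulrA; set w := rate * V in rV0 rV *.
  apply: (@le_trans _ _ ((1 + 5 / 4 * (126 / 100 * s)) / 2
      * (mu1 + 1 / 2 * dim_term))).
    by apply: ler_pM => //; lra.
  have := mu1_gt0; set m := mu1 => m0.
  have se : s * dim_term <= 1733 / 1000 * dim_term by rewrite ler_pM2r// ltW.
  have sm : 0 <= s * m by rewrite mulr_ge0// ltW.
  lra.
have dm := delta_hat_ge; rewrite muE in dm.
apply: (upper_numeric s0 mu1_gt0 dim_term_gt0 dm delta1 g1).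
by lra.
Qed.

End tuning.

(** * Asymptotics of the upper bound *)

Section asymptotics.
Context {R : realType}.

Lemma limn_esup_le_near (u : nat -> \bar R) (c : \bar R) :
  (\forall k \near \oo, (u k <= c)%E) -> (limn_esup u <= c)%E.
Proof.
move=> [N _ uN]; rewrite limn_esup_lim.
apply: lime_le; first exact: is_cvg_esups.
exists N => // n /= Nn; apply: ge_ereal_sup => _ [k /= nk <-].
by apply: uN => /=; exact: leq_trans nk.
Qed.

(** As [ln k <= k ^ s / s] with [s = 1 / (4 q)], the left-hand side is at most a
multiple of [k ^ (1 / 4)]. *)
Lemma log_power_le_sqrt (A B q c : R) : 0 <= A -> 0 <= B -> 0 < q -> 0 < c ->
  \forall k \near \oo,
    forall x, 0 <= x -> x <= A + B * ln k%:R -> x `^ q <= c * Num.sqrt k%:R.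
Proof.
move=> A0 B0 q0 c0.
pose s := (4 * q)^-1; have s0 : 0 < s by rewrite invr_gt0 mulr_gt0.
pose D := (A + B / s) `^ q; have D0 : 0 <= D by exact: powR_ge0.
near=> k => x x0 xk.
have k1 : 1 <= k%:R :> R by near: k; exact: nbhs_infty_ger.
have k0 : 0 < k%:R :> R by exact: lt_le_trans k1.
have ks1 : 1 <= k%:R `^ s :> R.
  by have := ler_powR k1 (ltW s0); rewrite powRr0.
have lnk : ln (k%:R : R) <= k%:R `^ s / s.
  rewrite ler_pdivlMr// mulrC -ln_powR.
  have := @le_ln1Dx R (k%:R `^ s - 1).
  rewrite addrCA subrr addr0 => /(_ _) H; apply: le_trans (H _) _; last by lra.
  by have := powR_gt0 s k0; lra.
have xks : x <= (A + B / s) * k%:R `^ s.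
  apply: (le_trans xk); rewrite mulrDl lerD ?ler_peMr//.
  by rewrite -mulrA [_^-1 * _]mulrC ler_wpM2l.
have ABs : 0 <= A + B / s by rewrite addr_ge0// divr_ge0// ltW.
have xq : x `^ q <= D * k%:R `^ 4^-1.
  have -> : k%:R `^ 4^-1 = (k%:R `^ s) `^ q :> R.
    rewrite -powRrM; congr (_ `^ _); rewrite /s; field.
    by rewrite gt_eqF.
  rewrite -powRM ?powR_ge0// ge0_ler_powR ?nnegrE ?(ltW q0)//.
  by rewrite mulr_ge0 ?powR_ge0.
have sqrtk : Num.sqrt k%:R = k%:R `^ 4^-1 * k%:R `^ 4^-1 :> R.
  rewrite -powR12_sqrt ?(ltW k0)// -powRD; last by rewrite gt_eqF.
  by congr (_ `^ _); field.
rewrite (le_trans xq)// sqrtk mulrA ler_wpM2r ?powR_ge0//.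
rewrite mulrC -ler_pdivrMr//.
have Dc : 0 <= D / c by rewrite divr_ge0// ltW.
have -> : D / c = ((D / c) ^+ 4) `^ 4^-1.
  by rewrite -powR_mulrn// -powRrM mulfV ?powRr1.
rewrite ge0_ler_powR ?nnegrE ?exprn_ge0// ?(ltW k0)//.
by near: k; exact: nbhs_infty_ger.
Unshelve. all: by end_near. Qed.

Lemma conv_div_fin (x y : R) : y != 0 -> conv_div x%:E y%:E = (x / y)%:E.
Proof.
move=> y0; rewrite /conv_div !eqe (negPf y0) andbF.
by rewrite inver (negPf y0) -EFinM.
Qed.

Lemma conv_div0 (x : R) : 0 < x -> conv_div x%:E 0 = +oo%E.
Proof.
move=> x0; rewrite /conv_div !eqe (gt_eqF x0) /= inver eqxx.
by rewrite mulry gtr0_sg// mul1e.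
Qed.

(** Eventually [gamma_plus_hat <= delta_hat <= 1 / 2], and then the bound is at
most [2 * delta_hat / (1 / 4)]. If [delta_hat] vanishes, so do [complexity] and
hence [gamma_plus_hat], and the ratio is 0 / 0 = 1. *)
Lemma upper_bound_order (d : nat) (kappa eps p alpha eta m : R) :
  1 < kappa -> 0 <= complexity d eps -> 0 < eps -> 0 < p -> 0 < alpha -> 0 < eta ->
  0 <= m ->
  (limn_esup (fun k : nat => conv_div
      (upper_bound d k kappa eps (gamma_plus_hat d k kappa eps p alpha eta m))
      (delta_hat d k kappa eps)%:E) <= 8%:E)%E.
Proof.
move=> k1 C0 eps0 p0 alpha0 eta0 m0; apply: limn_esup_le_near.
have k1_gt0 : 0 < kappa - 1 by rewrite subr_gt0.
have k_gt0 : 0 < kappa by exact: lt_trans k1.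
set C := complexity d eps in C0.
pose c := Num.sqrt (2 * (kappa - 1) * C) + 681 / 100 * Num.sqrt (2 * kappa * d%:R).
have c0 : 0 <= c.
  by rewrite /c; have := sqrtr_ge0 (2 * (kappa - 1) * C);
    have := sqrtr_ge0 (2 * kappa * d%:R); lra.
have muE k : (0 < k)%N -> mu_ d k kappa eps = c / Num.sqrt k%:R.
  move=> k0; have sqrt_div x : 0 <= x ->
      Num.sqrt (x / k%:R) = Num.sqrt x / Num.sqrt k%:R :> R.
    by move=> x0; rewrite sqrtrM// sqrtrV.
  rewrite /mu_ /c -/C (_ : _ / _ * C = 2 * (kappa - 1) * C / k%:R); last by ring.
  rewrite !sqrt_div; first by ring.
  - by nonneg.
  - by nonneg.
have gammaE k r4 : gamma_plus_of d k kappa eps r4 =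
    2 / 3 * (C / (kappa - 1)) * (1 + delta_hat d k kappa eps) ^+ 2 * (r4 / k%:R).
  rewrite /gamma_plus_of -/C; move: (delta_hat _ _ _ _) => t.
  by rewrite invfM invfM; ring.
have delta_lt k : (0 < k)%N -> mu_ d k kappa eps <= 1 / 4 ->
    mu_ d k kappa eps <= delta_hat d k kappa eps <= 1 / 2.
  move=> k_0 mk; have : 0 <= mu_ d k kappa eps by exact: mu_ge0.
  rewrite /delta_hat; move: (mu_ _ _ _ _) mk => x x4 x0.
  have den : 0 < 1 - 2 * x by lra.
  by rewrite ler_pdivlMr// ler_pdivrMr//; apply/andP; split; nra.
have [Cd0|Cd_neq0] := eqVneq c 0.
  have : Num.sqrt (2 * (kappa - 1) * C) = 0.
    by have := sqrtr_ge0 (2 * (kappa - 1) * C); have := sqrtr_ge0 (2 * kappa * d%:R);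
      rewrite /c in Cd0; lra.
  move=> /eqP; rewrite sqrtr_eq0 pmulr_rle0 ?mulr_gt0// => C_le0.
  have C_0 : C = 0 by apply/eqP; rewrite eq_le C_le0 C0.
  near=> k.
  have k_0 : (0 < k)%N by near: k; exact: nbhs_infty_gt.
  have d0 : delta_hat d k kappa eps = 0 by rewrite /delta_hat muE// Cd0 !mul0r.
  rewrite /gamma_plus_hat gammaE C_0 !(mul0r, mulr0) /upper_bound d0 !subr0 addr0.
  rewrite (_ : Num.max 1 0 = 1); last by rewrite max_l.
  rewrite mul1r conv_div_fin ?oner_neq0// mul0r /conv_div eqxx lee_fin.
  lra.
have c_gt0 : 0 < c by rewrite lt_neqAle eq_sym Cd_neq0.
pose q := 2 / p; have q0 : 0 < q by rewrite divr_gt0.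
pose B := 2 * alpha^-1; have B0 : 0 < B by rewrite mulr_gt0 ?invr_gt0.
pose A := m + B * `|ln eps| + eta.
have A0 : 0 <= A by rewrite /A !addr_ge0 ?(ltW eta0)// mulr_ge0// ltW.
pose e := c / (3 / 2 * (C / (kappa - 1)) + 1).
have e0 : 0 < e.
  have : 0 <= C / (kappa - 1) by rewrite divr_ge0// ltW.
  by rewrite /e => H; rewrite divr_gt0//; lra.
near=> k.
have k_gt1 : (0 < k)%N by near: k; exact: nbhs_infty_gt.
have kR : 0 < k%:R :> R by rewrite ltr0n.
have sk : 0 < Num.sqrt k%:R :> R by rewrite sqrtr_gt0.
have mk : mu_ d k kappa eps <= 1 / 4.
  rewrite muE// ler_pdivrMr// -ler_pdivrMl//.
  rewrite (_ : (1 / 4)^-1 * c = Num.sqrt ((4 * c) ^+ 2)); last first.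
    by rewrite sqrtr_sqr ger0_norm ?mulr_ge0//; field.
  rewrite ler_sqrt ?ler0n//.
  by near: k; exact: nbhs_infty_ger.
have /andP[d_lo d_hi] := delta_lt k k_gt1 mk.
have m_gt0 : 0 < mu_ d k kappa eps by rewrite muE// divr_gt0.
set t := delta_hat d k kappa eps in d_lo d_hi *.
have t0 : 0 < t by exact: lt_le_trans d_lo.
have k_eps : eps <= k%:R by near: k; exact: nbhs_infty_ger.
have levelE : tail_level k eps alpha eta m = m + B * (ln k%:R - ln eps) + eta.
  by rewrite /tail_level -/B ln_div.
have level0 : 0 <= tail_level k eps alpha eta m.
  rewrite levelE !addr_ge0 ?(ltW eta0)// mulr_ge0 ?(ltW B0)// subr_ge0.
  by rewrite ler_ln.
have level_le : tail_level k eps alpha eta m <= A + B * ln k%:R.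
  rewrite levelE /A; have : B * (- ln eps) <= B * `|ln eps|.
    by rewrite ler_pM2l// -normrN ler_norm.
  lra.
have r_le : tail_level k eps alpha eta m `^ q <= e * Num.sqrt k%:R.
  move: level0 level_le; move: (tail_level _ _ _ _ _); near: k.
  by apply: log_power_le_sqrt => //; exact: ltW.
pose g := gamma_plus_hat d k kappa eps p alpha eta m.
have g0 : 0 <= g.
  have pw0 := powR_ge0 (tail_level k eps alpha eta m) q.
  by rewrite /g /gamma_plus_hat gammaE -/t -/q; nonneg.
have g_le : g <= t.
  apply: le_trans d_lo; rewrite muE// /g /gamma_plus_hat gammaE -/t -/q.
  have t2 : (1 + t) ^+ 2 <= 9 / 4 by nra.
  have CK : 0 <= C / (kappa - 1) by rewrite divr_ge0// ltW.
  apply: (@le_trans _ _ (3 / 2 * (C / (kappa - 1)) * (e * Num.sqrt k%:R / k%:R))).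
    have h1 : 2 / 3 * (C / (kappa - 1)) * (1 + t) ^+ 2 <= 3 / 2 * (C / (kappa - 1)).
      by have := ler_wpM2l CK t2; lra.
    apply: ler_pM h1 _.
    - by rewrite mulr_ge0 ?sqr_ge0// mulr_ge0// divr_ge0.
    - by rewrite divr_ge0 ?powR_ge0.
    - by rewrite ler_wpM2r// invr_ge0 ltW.
  have skk : Num.sqrt k%:R / k%:R = (Num.sqrt k%:R)^-1 :> R.
    rewrite -[X in _ / X](sqr_sqrtr (ltW kR)) expr2 invfM mulrA divff ?mul1r//.
    by rewrite gt_eqF.
  rewrite -[e * _ / _]mulrA skk mulrA ler_pM2r ?invr_gt0//.
  rewrite /e mulrCA ler_piMr// ler_pdivrMr; lra.
rewrite /upper_bound -/t -/g.
have den : 0 < (1 - t) * (1 - g) by rewrite mulr_gt0; lra.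
rewrite max_l; last by lra.
rewrite conv_div_fin ?gt_eqF// conv_div_fin ?gt_eqF// lee_fin.
rewrite ler_pdivrMr// ler_pdivrMr//.
have : 1 / 4 <= (1 - t) * (1 - g).
  by apply: (@le_trans _ _ ((1 / 2) * (1 / 2))); [lra|apply: ler_pM; lra].
by move=> /(ler_wpM2l (ltW t0)); lra.
Unshelve. all: by end_near. Qed.

End asymptotics.

(** * Tail of the norms *)

Section tail.
Context {R : realType}.

(** Concavity of [t `^ p]: it lies below its tangent at 1. *)
Lemma powR_le_tangent (t p : R) : 0 <= t -> 0 < p -> p <= 1 ->
  t `^ p <= 1 - p + p * t.
Proof.
move=> t0 p0; rewrite le_eqVlt => /predU1P[->|p1].
  by rewrite powRr1// subrr add0r mul1r.
have q0 : 0 < 1 - p by rewrite subr_gt0.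
have := @conjugate_powR R (t `^ p) 1 p^-1 (1 - p)^-1 (powR_ge0 _ _) ler01.
rewrite !invr_gt0 !invrK p0 q0 => /(_ isT isT); rewrite addrC subrK => /(_ erefl).
rewrite mulr1 powR1 mul1r -powRrM mulfV ?gt_eqF// powRr1// => /le_trans; apply.
by rewrite addrC mulrC.
Qed.

Lemma powR_invr (t p : R) : 0 <= t -> 0 < p -> (t `^ p) `^ p^-1 = t.
Proof. by move=> t0 p0; rewrite -powRrM mulfV ?gt_eqF// powRr1. Qed.

Context {d : nat}.

Lemma enorm_powR (u : 'cV[R]_d) (p : R) : enorm u `^ (2 * p) = inner u u `^ p.
Proof. by rewrite powRrM powR_mulrn ?sqrtr_ge0// enorm_sqr. Qed.

Lemma gamma_plus_of_le n (kappa eps x y : R) : 1 < kappa ->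
  0 <= complexity d eps -> x <= y ->
  gamma_plus_of d n kappa eps x <= gamma_plus_of d n kappa eps y.
Proof.
move=> k1 C0 xy; rewrite /gamma_plus_of; move: (delta_hat _ _ _ _) => D.
have k0 : 0 <= kappa - 1 by rewrite subr_ge0 ltW.
by rewrite ler_wpM2r ?invr_ge0 ?mulr_ge0// ler_wpM2r ?sqr_ge0// ler_wpM2l// mulr_ge0.
Qed.

Section moments.
Context {d0 : measure_display} {T0 : measurableType d0} {P0 : probability T0 R}.
Variable X : {RV P0 >-> d.-tuple R}.
Hypothesis X2 : square_integrable X.

Lemma whitened_norm_powR x p :
  whitened_norm X x `^ (2 * p) = inner (white X x) (white X x) `^ p.
Proof. by rewrite enorm_powR. Qed.

Lemma measurable_whitened_powR p :
  measurable_fun [set: d.-tuple R] (fun x => inner (white X x) (white X x) `^ p).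
Proof.
by apply: (measurableT_comp (measurable_powR p)); exact: measurable_white_sqr.
Qed.

Lemma whitened_moment_le p : 0 < p -> p <= 1 ->
  0 <= whitened_moment X p <= d%:R `^ p.
Proof.
move=> p0 p1; rewrite /whitened_moment.
under eq_fun do rewrite whitened_norm_powR.
have f0 w : 0 <= inner (white X (X w)) (white X (X w)) `^ p by exact: powR_ge0.
apply/andP; split; first by rewrite fine_ge0// expectation_ge0.
have bound : ('E_P0[fun w => (inner (white X (X w)) (white X (X w)) `^ p)%R]
    <= (d%:R `^ p)%:E)%E.
  have g_mean := has_meanD (has_mean_cst P0 (d%:R `^ p * (1 - p)))
    (has_meanZ (d%:R `^ p * (p / d%:R)) (has_mean_white_norm2 X2)).
  apply: (le_trans (has_mean_expectation_le _ f0 _ g_mean)).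
  - exact: (measurableT_comp (measurable_whitened_powR p) (measurable_funPT X)).
  - move=> w; set S := inner _ _; have S0 : 0 <= S by exact: inner_ge0.
    have [d_0|d_gt0] := posnP d.
      rewrite (_ : S = 0) ?d_0; last first.
        by apply: big1 => j; have := ltn_ord j; rewrite [X in (_ < X)%N]d_0.
      by rewrite powR0 ?gt_eqF// mulr0 addr0 mul0r.
    have dR : 0 < d%:R :> R by rewrite ltr0n.
    rewrite -[in leLHS](divfK (lt0r_neq0 dR) S) powRM ?divr_ge0 ?(ltW dR)//.
    have := powR_le_tangent (divr_ge0 S0 (ltW dR)) p0 p1.
    move=> /(ler_wpM2l (powR_ge0 d%:R p)); rewrite mulrC => /le_trans; apply.
    by rewrite le_eqVlt; apply/orP; left; apply/eqP; ring.
  - rewrite lee_fin; have [d_0|d_gt0] := posnP d.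
      have -> : d%:R `^ p = 0 :> R by rewrite d_0 powR0 ?gt_eqF.
      by rewrite !mul0r addr0.
    have dR : 0 < d%:R :> R by rewrite ltr0n.
    rewrite -mulrA -mulrDr -[leRHS]mulr1 ler_wpM2l ?powR_ge0//.
    have /andP[_ rd] := white_proj_trace (psd_gram X2).
    have : p / d%:R * \tr (white_proj (gram X)) <= p.
      by rewrite mulrAC ler_pdivrMr// ler_wpM2l// ltW.
    by lra.
rewrite -lee_fin fineK// ge0_fin_numE ?expectation_ge0//.
exact: le_lt_trans bound (ltry _).
Qed.

End moments.

Section max_norm.
Context {n : nat} {d0 d1 : measure_display}.
Context {T0 : measurableType d0} {T : measurableType d1}.
Context {P0 : probability T0 R} {P : probability T R}.
Variables (X : {RV P0 >-> d.-tuple R}) (Xs : 'I_n -> {RV P >-> d.-tuple R}).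
Variables (alpha eta eps p : R).
Hypothesis X2 : square_integrable X.
Hypothesis laws : forall i, same_law X (Xs i).
Hypotheses (alpha_gt0 : 0 < alpha) (p_gt0 : 0 < p) (eps_gt0 : 0 < eps).
Hypothesis n_gt0 : (0 < n)%N.
Hypothesis X_exp : ('E_P0[fun w => expR (alpha / 2 *
  (whitened_norm X (X w) `^ (2 * p) - whitened_moment X p - eta))%R] <= 1)%E.

Let level := tail_level n eps alpha eta (whitened_moment X p).

(** Markov's inequality gives each sample point the probability [eps / n] to exceed
the level, because of the term [2 / alpha * ln (n / eps)] in it. *)
Lemma white_norm_tail : exists A : set T, [/\ measurable A,
  (P (~` A) <= eps%:E)%E & forall w, A w -> forall i,
    inner (white X (Xs i w)) (white X (Xs i w)) <= level `^ p^-1].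
Proof.
have nR : 0 < n%:R :> R by rewrite ltr0n.
pose f (x : d.-tuple R) := expR (alpha / 2 *
  (inner (white X x) (white X x) `^ p - whitened_moment X p - eta)).
have mf : measurable_fun [set: d.-tuple R] f.
  apply: (measurableT_comp (@measurable_expR R)); apply: measurable_funM => //.
  do 2![apply: measurable_funB => //]; exact: measurable_whitened_powR.
have mfX i : measurable_fun [set: T] (fun w => f (Xs i w)).
  exact: (measurableT_comp mf (measurable_funPT (Xs i))).
have intf : (\int[P0]_w (f (X w))%:E <= 1%:E)%E.
  rewrite (le_trans _ X_exp)// unlock le_eqVlt; apply/orP; left; apply/eqP.
  by apply: eq_integral => w _; rewrite whitened_norm_powR.
pose B i := [set w | (n%:R / eps <= f (Xs i w))%R].
have PB i : i \in [set: 'I_n]%SET -> (P (B i) <= (eps / n%:R)%:E)%E.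
  move=> _; have intfi : (\int[P]_w (f (Xs i w))%:E <= 1%:E)%E.
    by rewrite (integral_same_law (laws i) mf (fun y => expR_ge0 _)).
  have := markov_ineq (mfX i) (fun w => expR_ge0 _) (divr_gt0 nR eps_gt0) intfi.
  by rewrite mul1r invf_div.
have mB i : measurable (B i).
  rewrite -[B i]setTI.
  exact: (measurable_fun_le measurableT (measurable_cst _) (mfX i)).
have [mU PU] := union_bound mB PB.
exists (~` \bigcup_(i in [set` [set: 'I_n]%SET]) B i); split.
- exact: measurableC.
- rewrite setCK (le_trans PU)// lee_fin cardsT card_ord.
  by rewrite mulrCA divff ?mulr1 ?gt_eqF.
- move=> w Aw i; set S := inner _ _; have S0 : 0 <= S by exact: inner_ge0.
  have Sp : S `^ p <= level.
    rewrite leNgt; apply/negP => levelS; apply: Aw; exists i; first by rewrite /= inE.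
    rewrite /B /= /f -/S -[leLHS]lnK ?posrE ?divr_gt0// ler_expR.
    move: levelS; rewrite /level /tail_level.
    move: (ln _) (whitened_moment X p) (S `^ p) => l m s H.
    have -> : l = alpha / 2 * (2 * alpha^-1 * l) by field; rewrite gt_eqF.
    by rewrite ler_pM2l ?divr_gt0//; lra.
  have level0 : 0 <= level by apply: le_trans Sp; exact: powR_ge0.
  rewrite -[leLHS](powR_invr S0 p_gt0) ge0_ler_powR ?nnegrE ?powR_ge0//.
  by rewrite invr_ge0 ltW.
Qed.

Lemma max_whitened_norm_le (M : R) w : 0 <= M ->
  (forall i, inner (white X (Xs i w)) (white X (Xs i w)) <= M) ->
  max_whitened_norm X Xs w ^+ 4 <= M ^+ 2.
Proof.
move=> M0 SM; have max0 : 0 <= max_whitened_norm X Xs w.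
  rewrite /max_whitened_norm; elim/big_ind : _ => // [x y x0 y0|i _].
    by rewrite le_max x0.
  exact: sqrtr_ge0.
rewrite (exprM _ 2 2) lerXn2r ?nnegrE ?sqr_ge0//.
have : max_whitened_norm X Xs w <= Num.sqrt M.
  rewrite /max_whitened_norm; elim/big_ind : _ => [|x y xM yM|i _].
  - exact: sqrtr_ge0.
  - by rewrite ge_max xM.
  - by rewrite ler_sqrt// SM.
by move=> H; rewrite -[leRHS](sqr_sqrtr M0) lerXn2r ?nnegrE ?sqrtr_ge0.
Qed.

End max_norm.

End tail.

(** * The three events *)

Section events.
Context {R : realType} {d n : nat} {d0 d1 : measure_display}.
Context {T0 : measurableType d0} {T : measurableType d1}.
Context {P0 : probability T0 R} {P : probability T R}.
Variables (X : {RV P0 >-> d.-tuple R}) (Xs : 'I_n -> {RV P >-> d.-tuple R}).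
Hypothesis X2 : square_integrable X.
Hypothesis copies : independent_copies X Xs.

Let G := gram X.
Let psdG := psd_gram X2.

(** The sample points almost surely lie in the image of [G], so that inner
products with them can be computed in whitened coordinates. *)
Lemma white_coord_event : exists A : set T, [/\ measurable A,
  (P (~` A) <= 0%:E)%E & forall w, A w -> forall i theta,
    inner theta (vec (Xs i w)) = inner (white_coord G theta) (white X (Xs i w))].
Proof.
pose Gp := pseudo_inverse G.
have [[GGG _ Gtr _] [symGp _]] := pseudo_inverseP psdG; have [symG _] := psdG.
rewrite -/Gp in GGG Gtr symGp.
pose u (j : 'I_d) : 'cV[R]_d := (1%:M - Gp *m G) *m delta_mx j 0.
have Gu j : G *m u j = 0 by rewrite mulmxA mulmxBr mulmx1 mulmxA GGG subrr mul0mx.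
have null i j : exists2 N : set T, measurable N /\ P N = 0%E &
    forall w, ~ N w -> inner (u j) (vec (Xs i w)) = 0.
  have mu2 : measurable_fun [set: d.-tuple R] (fun x => inner (u j) (vec x) ^+ 2).
    by apply: measurable_funX; exact: measurable_inner.
  have int0 : (\int[P]_w (inner (u j) (vec (Xs i w)) ^+ 2)%:E = 0)%E.
    rewrite (@integral_same_law _ _ _ _ _ _ _ P0 P n X Xs i _ (copies.2 i) mu2)//.
      have [_] := has_mean_energy X2 (u j); rewrite unlock => ->.
      by rewrite Gu /inner big1// => k _; rewrite [X in _ * X]mxE mulr0.
    by move=> y; exact: sqr_ge0.
  have mf : measurable_fun [set: T] (fun w => (inner (u j) (vec (Xs i w)) ^+ 2)%:E).
    apply/measurable_EFinP.
    exact: (measurableT_comp mu2 (measurable_funPT (Xs i))).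
  have /(ae_eq_integral_abs P measurableT mf)[N [mN PN Nsub]] :
      (\int[P]_w `|(inner (u j) (vec (Xs i w)) ^+ 2)%:E| = 0)%E.
    rewrite -[RHS]int0; apply: eq_integral => w _.
    by rewrite gee0_abs// lee_fin sqr_ge0.
  exists N => // w Nw; apply/eqP; rewrite -sqrf_eq0; apply/eqP/EFin_inj.
  by apply: contrapT => H; apply: Nw; apply: Nsub => /= /(_ I).
pose N (ij : 'I_n * 'I_d) := s2val (cid2 (null ij.1 ij.2)).
have mN ij : measurable (N ij) by rewrite /N; case: cid2 => ? [].
have PN ij : ij \in [set: 'I_n * 'I_d]%SET -> (P (N ij) <= 0%:E)%E.
  by move=> _; rewrite /N; case: cid2 => /= ? [_ ->].
have [mU PU] := union_bound mN PN.
exists (~` \bigcup_(ij in [set` [set: 'I_n * 'I_d]%SET]) N ij); split.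
- exact: measurableC.
- by rewrite setCK (le_trans PU)// mulr0.
- move=> w Aw i theta; rewrite inner_white_coord_whitening// -/Gp mulmxA.
  have -> : vec (Xs i w) = G *m Gp *m vec (Xs i w) + (1%:M - G *m Gp) *m vec (Xs i w).
    by rewrite mulmxBl mul1mx addrC subrK.
  rewrite (_ : (1%:M - _) *m _ = 0).
    by rewrite addr0 !mulmxA GGG.
  apply/colP => j; rewrite [RHS]mxE -inner_delta.
  have -> : (1%:M - G *m Gp) = (1%:M - Gp *m G)^T.
    by rewrite linearB /= trmx1 trmx_mul symG symGp.
  rewrite -inner_mulmx -/(u j).
  have Nw : ~ N (i, j) w by move=> Nw; apply: Aw; exists (i, j); rewrite /= ?inE.
  by move: Nw; rewrite /N; case: cid2 => /= N' _; exact.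
Qed.

Variables (kappa eps : R).
Hypothesis X4 : (ereal_sup [set fourth_moment X theta
  | theta in [set theta : 'cV[R]_d | (energy X theta <= 1)%E]] <= kappa%:E)%E.
Hypotheses (d_gt0 : (0 < d)%N) (kappa_gt1 : 1 < kappa) (eps_gt0 : 0 < eps).
Hypothesis C_ge : 73 / 100 * d%:R < complexity d eps.
Hypothesis n_large : sample_threshold d kappa eps < n%:R.

Let n_gt0 : (0 < n)%N.
Proof. by rewrite -(ltr0n R); exact: sample_gt0 n_large. Qed.

Let C_ge0 : 0 <= complexity d eps.
Proof. by apply: le_trans (ltW C_ge); rewrite mulr_ge0. Qed.

Let delta := delta_hat d n kappa eps.

Lemma white_empirical_ge0 xi w : 0 <= white_empirical X Xs xi w.
Proof.
by rewrite mulr_ge0 ?invr_ge0// sumr_ge0// => i _; exact: sqr_ge0.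
Qed.

(** If [gamma_minus >= 1] the lower bound is at most -1, and the event is the whole
space. *)
Lemma lower_event : exists A : set T, [/\ measurable A,
  (P (~` A) <= eps%:E)%E & forall w, A w -> forall xi, white_sphere X xi ->
    - lower_bound d n kappa eps <= white_empirical X Xs xi w - 1].
Proof.
have [g1|g1] := leP 1 (gamma_minus d n kappa eps).
  exists setT; split=> //; first by rewrite setCT measure0 lee_fin ltW.
  move=> w _ xi _; have := white_empirical_ge0 xi w.
  have : 1 <= lower_bound d n kappa eps.
    have delta0 := delta_hat_ge0 kappa_gt1 C_ge0 n_large.
    by rewrite ler_pdivlMr; lra.
  by lra.
have c45 : 0 < 4 / 5 :> R by rewrite divr_gt0.
have [Kc cost] := lower_tail_cost d_gt0 kappa_gt1 C_ge n_large g1.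
have [A [mA PA AE]] := uniform_lower X2 kappa_gt1 X4 copies d_gt0 n_gt0
  (grid_mesh_gt0 d_gt0 kappa_gt1 C_ge) (grid_radius_ge0 d_gt0 kappa_gt1 C_ge)
  (grid_ratio_gt0 d_gt0 kappa_gt1 C_ge) (rate_gt0 kappa_gt1 C_ge n_large)
  c45 eps_gt0
  (grid_mesh_radius kappa eps d_gt0) (grid_mesh_ratio d_gt0 kappa_gt1 C_ge)
  (norm_cutoff_gt0 d_gt0 kappa_gt1 n_large) Kc.
exists A; split=> // w Aw xi xiS.
by have := AE w Aw xi xiS; lra.
Qed.

(** If [delta] or [gamma_plus] reaches 1, the upper bound is infinite. *)
Lemma upper_event (M : R) : 0 <= M -> exists A : set T, [/\ measurable A,
  (P (~` A) <= eps%:E)%E & forall w, A w ->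
    (forall i, inner (white X (Xs i w)) (white X (Xs i w)) <= M) ->
    delta <= 1 -> forall xi, white_sphere X xi ->
    ((white_empirical X Xs xi w - 1)%:E <=
      upper_bound d n kappa eps (gamma_plus_of d n kappa eps (M ^+ 2)))%E].
Proof.
move=> M0; set g := gamma_plus_of _ _ _ _ _.
have delta0 := delta_hat_gt0 d_gt0 kappa_gt1 C_ge n_large.
have g0 : 0 <= g.
  rewrite /g (gamma_plus_ofE kappa_gt1 C_ge n_large).
  by have sq := sqr_ge0 M; rewrite -/delta; nonneg.
have infinite : (1 - delta) * Num.max (1 - g) 0 = 0 ->
    upper_bound d n kappa eps g = +oo%E.
  by rewrite /upper_bound -/delta => ->; rewrite conv_div0// ltr_wpDr.
have trivial_event : (1 - delta) * Num.max (1 - g) 0 = 0 ->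
    exists A : set T, [/\ measurable A,
    (P (~` A) <= eps%:E)%E & forall w, A w ->
      (forall i, inner (white X (Xs i w)) (white X (Xs i w)) <= M) ->
      delta <= 1 -> forall xi, white_sphere X xi ->
      ((white_empirical X Xs xi w - 1)%:E <= upper_bound d n kappa eps g)%E].
  move=> /infinite ->; exists setT; split=> //.
    by rewrite setCT measure0 lee_fin ltW.
  by move=> *; exact: leey.
have [g1|g1] := leP 1 g.
  by apply: trivial_event; rewrite max_r ?mulr0// subr_le0.
have /orP[delta1|delta1] : (1 < delta) || (delta <= 1) by case: ltP.
  exists setT; split=> //; first by rewrite setCT measure0 lee_fin ltW.
  by move=> w _ _; rewrite leNgt delta1.
have [delta_eq1|delta_neq1] := eqVneq delta 1.
  by apply: trivial_event; rewrite delta_eq1 subrr mul0r.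
have {delta1 delta_neq1} delta1 : delta < 1 by rewrite lt_neqAle delta_neq1.
have c54 : 0 < 5 / 4 :> R by rewrite divr_gt0.
have [Kc cost] := upper_tail_cost d_gt0 kappa_gt1 C_ge n_large M0 g1 delta1.
have [A [mA PA AE]] := uniform_upper X2 kappa_gt1 X4 copies n_gt0
  (grid_mesh_gt0 d_gt0 kappa_gt1 C_ge) (grid_radius_ge0 d_gt0 kappa_gt1 C_ge)
  (grid_ratio_gt0 d_gt0 kappa_gt1 C_ge) (rate_gt0 kappa_gt1 C_ge n_large)
  c54 eps_gt0
  (grid_mesh_radius kappa eps d_gt0) (grid_mesh_ratio d_gt0 kappa_gt1 C_ge)
  M0 Kc.
exists A; split=> // w Aw SM _ xi xiS.
rewrite /upper_bound -/delta max_l; last by rewrite subr_ge0 ltW.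
rewrite conv_div_fin; last by rewrite gt_eqF// mulr_gt0 ?subr_gt0.
rewrite lee_fin; have := AE w Aw SM xi xiS.
by move: cost; rewrite -/delta -/g; lra.
Qed.

End events.

Section relative_errors.
Context {R : realType} {d n : nat} {d0 d1 : measure_display}.
Context {T0 : measurableType d0} {T : measurableType d1}.
Context {P0 : probability T0 R} {P : probability T R}.
Variables (X : {RV P0 >-> d.-tuple R}) (Xs : 'I_n -> {RV P >-> d.-tuple R}).
Hypothesis X2 : square_integrable X.

(** The first case is that of a direction without energy; in the other one the
whitened direction is normalized. *)
Lemma relative_error_white w theta :
  (forall i, inner theta (vec (Xs i w)) =
     inner (white_coord (gram X) theta) (white X (Xs i w))) ->
  relative_error X Xs theta w = 0%E \/
  exists2 xi, white_sphere X xi &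
    relative_error X Xs theta w = (white_empirical X Xs xi w - 1)%:E.
Proof.
have psdG := psd_gram X2; set xi := white_coord _ _ => thetaE.
rewrite /relative_error energyE// -(inner_white_coord psdG) -/xi.
set N := inner xi xi; have N0 : 0 <= N by exact: inner_ge0.
have empE : empirical_energy Xs theta w = white_empirical X Xs xi w.
  by congr (_ * _); apply: eq_bigr => i _; rewrite thetaE.
rewrite empE; have [N00|N_neq0] := eqVneq N 0.
  left; have xi0 : xi = 0 by exact: inner_eq0.
  rewrite N00 (_ : white_empirical _ _ _ _ = 0); last first.
    rewrite /white_empirical big1 ?mulr0// => i _.
    by rewrite xi0 /inner big1 ?expr0n// => j _; rewrite mxE mul0r.
  by rewrite /conv_div eqxx subee.
have N_gt0 : 0 < N by rewrite lt_neqAle eq_sym N_neq0.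
right; exists ((Num.sqrt N)^-1 *: xi).
  split; last by rewrite -scalemxAr white_proj_coord.
  rewrite innerZl innerZr mulrA -expr2 exprVn sqr_sqrtr// mulVf//.
rewrite conv_div_fin// -EFinB; congr (_ - _)%:E.
rewrite /white_empirical mulrC mulrCA; congr (_ * _).
rewrite mulr_sumr; apply: eq_bigr => i _.
by rewrite innerZl exprMn exprVn sqr_sqrtr.
Qed.

End relative_errors.

Section probability_of_events.
Context {R : realType} {d : measure_display} {T : measurableType d}.
Variable P : probability T R.

Lemma prob_at_least_event (E A : set T) (e : R) : measurable A -> A `<=` E ->
  (P (~` A) <= e%:E)%E -> prob_at_least P E (1 - e).
Proof.
move=> mA AE; rewrite probability_setC// => PA; exists A; split=> //.
move: PA; rewrite -(@fineK _ (P A)) ?fin_num_measure// -EFinB !lee_fin.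
by lra.
Qed.

Lemma prob_setCI (A B : set T) (a b : R) : measurable A -> measurable B ->
  (P (~` A) <= a%:E)%E -> (P (~` B) <= b%:E)%E ->
  (P (~` (A `&` B)) <= (a + b)%:E)%E.
Proof.
move=> mA mB PA PB; rewrite setCI.
by rewrite (le_trans (measureU2 _ _ _)) ?EFinD ?leeD//; exact: measurableC.
Qed.

End probability_of_events.

Lemma conv_div_ge0 (R : realType) (x y : R) : 0 <= x -> 0 <= y ->
  (0 <= conv_div x%:E y%:E)%E.
Proof.
move=> x0 y0; have [->|y_neq0] := eqVneq y 0; last first.
  by rewrite conv_div_fin// lee_fin divr_ge0.
have [->|x_neq0] := eqVneq x 0; first by rewrite /conv_div eqxx lee_fin.
by rewrite conv_div0 ?leey// lt_neqAle eq_sym x_neq0.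
Qed.

Theorem proposition2p3 (R : realType) :
  exists (c1 : R -> R) (c2 c3 : R),
    (forall k k' : R, 1 < k -> k <= k' -> c1 k' <= c1 k) /\
  forall (d n : nat) (d0 d1 : measure_display)
    (T0 : measurableType d0) (T : measurableType d1)
    (P0 : probability T0 R) (P : probability T R)
    (X : {RV P0 >-> d.-tuple R}) (Xs : 'I_n -> {RV P >-> d.-tuple R})
    (kappa p alpha eta eps : R),
  square_integrable X ->
  independent_copies X Xs ->
  1 < kappa ->
  (ereal_sup [set fourth_moment X theta
             | theta in [set theta : 'cV[R]_d | (energy X theta <= 1)%E]]
    <= kappa%:E)%E ->
  0 < p -> p <= 1 -> 0 < alpha -> 0 < eta ->
  ('E_P0[fun w => expR (alpha / 2 * (whitened_norm X (X w) `^ (2 * p)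
                                     - whitened_moment X p - eta))%R]
    <= 1)%E ->
  0 < eps -> 0 <= complexity d eps ->
  sample_threshold d kappa eps < n%:R ->
  let delta := delta_hat d n kappa eps in
  let gamma_hat k := gamma_plus_hat d k kappa eps p alpha eta in
  let m := whitened_moment X p in
  [/\ 0 <= tail_level n eps alpha eta m ->
        gamma_hat n m <= gamma_hat n (d%:R `^ p),
      prob_at_least P
        [set w | gamma_plus X Xs kappa eps w <= gamma_hat n m]
        (1 - eps),
      prob_at_least P
        [set w | forall theta : 'cV[R]_d,
           ((- lower_bound d n kappa eps)%:E <= relative_error X Xs theta w)%E /\
           (delta <= 1 ->
            (relative_error X Xs theta w
              <= upper_bound d n kappa eps (gamma_hat n m))%E)]
        (1 - 3 * eps) &
   [/\ lower_bound d n kappa eps <= c1 kappa * delta,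
      (limn_esup (fun k : nat =>
         conv_div (upper_bound d k kappa eps (gamma_hat k m))
               (delta_hat d k kappa eps)%:E) <= c2%:E)%E &
      delta <= c3 * Num.sqrt (kappa * (d%:R + ln eps^-1) / n%:R)]].
Proof.
exists (fun k => 1 + (3 * (k - 1) ^+ 2)^-1), 8, 629; split.
  move=> k k' k1 kk'; have k'1 : 1 < k' by exact: lt_le_trans kk'.
  have sq_gt0 x : 1 < x -> 0 < 3 * (x - 1) ^+ 2 :> R.
    by move=> x1; rewrite mulr_gt0// exprn_gt0// subr_gt0.
  rewrite lerD2l lef_pV2 ?posrE ?sq_gt0// ler_pM2l// lerXn2r ?nnegrE ?lerD2r//.
    by rewrite subr_ge0 ltW.
  by rewrite subr_ge0 ltW.
move=> d n d0 d1 T0 T P0 P X Xs kappa p alpha eta eps X2 copies kappa_gt1 X4 p_gt0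
  p_le1 alpha_gt0 eta_gt0 X_exp eps_gt0 C_ge0 n_large delta gamma_hat m.
have n_gt0 : (0 < n)%N by rewrite -(ltr0n R); exact: sample_gt0 n_large.
have /andP[m_ge0 m_le] := whitened_moment_le X2 p_gt0 p_le1.
have delta_ge0 := delta_hat_ge0 kappa_gt1 C_ge0 n_large.
set level := tail_level n eps alpha eta m.
pose M := level `^ p^-1; have M_ge0 : 0 <= M by exact: powR_ge0.
have gammaE : gamma_hat n m = gamma_plus_of d n kappa eps (M ^+ 2).
  by rewrite /gamma_hat /gamma_plus_hat /M -powR_mulrn ?powR_ge0// -powRrM mulrC.
have [A [mA PA AE]] := white_norm_tail X2 copies.2 alpha_gt0 p_gt0 eps_gt0 n_gt0 X_exp.
split.
- move=> level0; apply: gamma_plus_of_le => //.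
  have level_le : level <= tail_level n eps alpha eta (d%:R `^ p).
    by rewrite /level /tail_level !lerD.
  apply: ge0_ler_powR; rewrite ?nnegrE ?divr_ge0 ?(ltW p_gt0)//.
  exact: le_trans level_le.
- apply: (prob_at_least_event mA _ PA) => w /AE wM /=.
  by rewrite gammaE; apply: gamma_plus_of_le => //; exact: max_whitened_norm_le.
- have [eps3|eps3] := leP 1 (3 * eps).
    exists set0; split=> //; rewrite measure0 lee_fin; lra.
  have C_ge : 73 / 100 * d%:R < complexity d eps.
    rewrite /complexity ltrDr ln_gt0// invf_gt1//; lra.
  have lower_ge0 : 0 <= lower_bound d n kappa eps.
    apply: divr_ge0; last by rewrite addr_ge0.
    rewrite addr_ge0// divr_ge0 ?mulr_ge0// subr_ge0 ltW//.
  have g_ge0 : 0 <= gamma_hat n m.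
    rewrite /gamma_hat /gamma_plus_hat /gamma_plus_of.
    have pw := powR_ge0 (tail_level n eps alpha eta m) (2 / p).
    have k1 : 0 < kappa - 1 by rewrite subr_gt0.
    by rewrite -/delta; nonneg.
  have upper_ge0 : delta <= 1 -> (0 <= upper_bound d n kappa eps (gamma_hat n m))%E.
    move=> delta1; apply: conv_div_ge0; first by rewrite addr_ge0.
    by rewrite mulr_ge0 ?subr_ge0// le_max lexx orbT.
  have [A0 [mA0 PA0 A0E]] := white_coord_event X2 copies.
  have no_sphere : d = 0%N -> forall xi : 'cV[R]_d, ~ white_sphere X xi.
    move=> d_0 xi [xi1 _]; have : inner xi xi = 0.
      by apply: big1 => j; have := ltn_ord j; rewrite [X in (_ < X)%N]d_0.
    by rewrite xi1 => /eqP; rewrite oner_eq0.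
  have PT : (P (~` [set: T]) <= eps%:E)%E by rewrite setCT measure0 lee_fin ltW.
  have [A1 [mA1 PA1 A1E]] : exists A : set T, [/\ measurable A,
      (P (~` A) <= eps%:E)%E & forall w, A w -> forall xi, white_sphere X xi ->
      - lower_bound d n kappa eps <= white_empirical X Xs xi w - 1].
    have [d_0|d_gt0] := posnP d; last exact: lower_event.
    by exists setT; split=> // w _ xi /(no_sphere d_0).
  have [A2 [mA2 PA2 A2E]] : exists A : set T, [/\ measurable A,
      (P (~` A) <= eps%:E)%E & forall w, A w ->
      (forall i, inner (white X (Xs i w)) (white X (Xs i w)) <= M) ->
      delta <= 1 -> forall xi, white_sphere X xi ->
      ((white_empirical X Xs xi w - 1)%:E <=
        upper_bound d n kappa eps (gamma_hat n m))%E].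
    rewrite gammaE; have [d_0|d_gt0] := posnP d; last exact: upper_event.
    by exists setT; split=> // w _ _ _ xi /(no_sphere d_0).
  have PI := prob_setCI mA0 (measurableI _ _ mA (measurableI _ _ mA1 mA2)) PA0
    (prob_setCI mA (measurableI _ _ mA1 mA2) PA (prob_setCI mA1 mA2 PA1 PA2)).
  rewrite (_ : 1 - 3 * eps = 1 - (0 + (eps + (eps + eps)))); last by ring.
  apply: (prob_at_least_event _ _ PI).
    by apply: measurableI => //; apply: measurableI => //; exact: measurableI.
  move=> w [/A0E wE [/AE wM [/A1E wlo /A2E/(_ wM) wup]]] theta.
  have [->|[xi xiS ->]] := relative_error_white X2 (fun i => wE i theta).
    by split=> //; rewrite lee_fin oppr_le0.
  by split=> [|delta1]; [rewrite lee_fin; exact: wlo|exact: wup].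
- split.
  + exact: lower_bound_le.
  + exact: upper_bound_order.
  + exact: delta_hat_order.
Qed.
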